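(* Let $A$ be a basic finite dimensional $k$-algebra, let $e$ be a primitive idempotent of $A$, let $\Gamma=(1-e)A(1-e)$ and let $S_e=eA/e\,\mathrm{rad}A$. Assume that both $\mathrm{pd}_A S_e$ and $\mathrm{pd}_\Gamma(eA(1-e))$ are finite. Then $\mathrm{Ext}_A^i(S_e,S_e)=0$ for all $i>0$.
   Context: $k$ is an algebraically closed field. Algebras are associative and unital. $\mathrm{rad}A$ is the Jacobson radical of $A$. Basic means that $A/\mathrm{rad}A$ is a finite product of copies of $k$. $S_e$ is viewed as a right $A$-module and $eA(1-e)$ as a right $\Gamma$-module; $\mathrm{pd}$ denotes projective dimension. *)

(* Defs.v *)
From HB Require Import structures.
From mathcomp Require Import all_boot all_order all_algebra all_field.
From mathcomp Require Import boolp classical_sets functions.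

Set Implicit Arguments.
Unset Strict Implicit.
Unset Printing Implicit Defensive.
Import GRing.Theory.
Local Open Scope ring_scope.
Local Open Scope quotient_scope.

(* A right R-module is an object of [lmodType R^c], R^c being the opposite    *)
(* ring: the scalar product a *: x is then the right action x.a               *)

Section QuotientModule.
Variables (R : pzRingType) (M : lmodType R) (N : {pred M}).
Hypothesis N_submod : submod_closed N.

Let N_zmod : zmodClosed M :=
  HB.pack N (GRing.isZmodClosed.Build M N (GRing.submod_closedB N_submod)).

Definition quotmod : Type := Quotient.quot N_zmod.
HB.instance Definition _ := GRing.Zmodule.on quotmod.

Definition quotmod_pi (x : M) : quotmod := \pi_(Quotient.quot N_zmod) x.

Definition quotmod_scale (a : R) (x : quotmod) : quotmod :=
  quotmod_pi (a *: repr (x : Quotient.quot N_zmod)).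

Lemma quotmod_piP (x : quotmod) : exists y, quotmod_pi y = x.
Proof. by exists (repr (x : Quotient.quot N_zmod)); rewrite /quotmod_pi reprK. Qed.

Lemma quotmod_pi_eq (x y : M) : (quotmod_pi x = quotmod_pi y) <-> (x - y \in N).
Proof.
rewrite /quotmod_pi -[_ \in N](Quotient.equivE N_zmod); split.
  by move/eqP; rewrite eqmodE.
by move=> h; apply/eqP; rewrite eqmodE.
Qed.

Lemma quotmod_piD (x y : M) : quotmod_pi (x + y) = quotmod_pi x + quotmod_pi y.
Proof. exact: (raddfD (\pi_(Quotient.quot N_zmod))). Qed.

Lemma quotmod_piZ a (x : M) : quotmod_scale a (quotmod_pi x) = quotmod_pi (a *: x).
Proof.
apply/quotmod_pi_eq; rewrite -scalerBr.
have [N0 NZD] := N_submod; rewrite -[_ *: _]addr0; apply: NZD => //.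
apply/quotmod_pi_eq; by rewrite /quotmod_pi reprK.
Qed.

Fact quotmod_scaleA a b x :
  quotmod_scale a (quotmod_scale b x) = quotmod_scale (a * b) x.
Proof. by have [y <-] := quotmod_piP x; rewrite !quotmod_piZ scalerA. Qed.
Fact quotmod_scale1 : left_id 1 quotmod_scale.
Proof. by move=> x; have [y <-] := quotmod_piP x; rewrite quotmod_piZ scale1r. Qed.
Fact quotmod_scaleDr : right_distributive quotmod_scale +%R.
Proof.
move=> a x x'; have [y <-] := quotmod_piP x; have [y' <-] := quotmod_piP x'.
by rewrite -quotmod_piD !quotmod_piZ scalerDr quotmod_piD.
Qed.
Fact quotmod_scaleDl x : {morph quotmod_scale^~ x : a b / a + b}.
Proof.
by move=> a b; have [y <-] := quotmod_piP x; rewrite !quotmod_piZ scalerDl quotmod_piD.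
Qed.
HB.instance Definition _ := GRing.Zmodule_isLmodule.Build R quotmod
  quotmod_scaleA quotmod_scale1 quotmod_scaleDr quotmod_scaleDl.

End QuotientModule.

Definition projective (R : pzRingType) (P : lmodType R) : Prop :=
  forall (M N : lmodType R) (p : {linear M -> N}) (g : {linear P -> N}),
    (forall y, exists x, p x = y) ->
    exists h : {linear P -> M}, forall x, p (h x) = g x.

(* ... -> P_2 -> P_1 -> P_0 -> M -> 0, with res_d i : P_(i+1) -> P_i *)
Record proj_resolution (R : pzRingType) (M : lmodType R) := ProjResolution {
  res_obj :> nat -> lmodType R;
  res_d : forall i, {linear res_obj i.+1 -> res_obj i};
  res_aug : {linear res_obj 0%N -> M};
  res_proj : forall i, projective (res_obj i);
  res_aug_surj : forall y, exists x, res_aug x = y;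
  res_aug_exact : forall x, res_aug x = 0 <-> exists y, res_d 0%N y = x;
  res_exact : forall i x, res_d i x = 0 <-> exists y, res_d i.+1 y = x
}.

Definition pd_le (R : pzRingType) (M : lmodType R) (n : nat) : Prop :=
  exists P : proj_resolution M, forall i, (n < i)%N -> forall x : P i, x = 0.

Definition pd_finite (R : pzRingType) (M : lmodType R) : Prop :=
  exists n, pd_le M n.

(* [Ext P i N] is the i-th cohomology group of the complex Hom_R(P, N). *)
Section Ext.
Variables (R : pzRingType) (M : lmodType R) (P : proj_resolution M).
Variables (i : nat) (N : lmodType R).

Definition cocycle : {pred P i -> N} :=
  fun f => `[< linear f /\ forall x, f (res_d P i x) = 0 >].

Fact cocycle_zmod_closed : zmod_closed cocycle.
Proof.
split=> [|f g /asboolP[lf f0] /asboolP[lg g0]]; apply/asboolP.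
  by split=> // a x y; rewrite /= scaler0 addr0.
split=> [a x y|x]; rewrite !fctE; last by rewrite f0 g0 subrr.
by rewrite lf lg scalerBr opprD addrACA.
Qed.
HB.instance Definition _ :=
  GRing.isZmodClosed.Build (P i -> N) cocycle cocycle_zmod_closed.

Definition cocycles := {f : P i -> N | f \in cocycle}.
HB.instance Definition _ := SubChoice.on cocycles.
HB.instance Definition _ := [SubChoice_isSubZmodule of cocycles by <:].

End Ext.

Section Coboundary.
Variables (R : pzRingType) (M : lmodType R) (P : proj_resolution M).

Definition is_coboundary (N : lmodType R) (i : nat) : (P i -> N) -> Prop :=
  match i with
  | 0%N => fun f => f = 0
  | j.+1 => fun f => exists g : {linear P j -> N}, forall x, f x = g (res_d P j x)
  end.

Fact is_coboundary0 (N : lmodType R) i : @is_coboundary N i 0.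
Proof. by case: i => [|j] //=; exists (\0 : {linear P j -> N}). Qed.

Fact is_coboundaryB (N : lmodType R) i (f g : P i -> N) :
  is_coboundary f -> is_coboundary g -> is_coboundary (f - g).
Proof.
case: i f g => [|j] f g /=; first by move=> -> ->; rewrite subrr.
move=> [f' hf] [g' hg]; exists (f' \- g' : {linear P j -> N}) => x.
by rewrite /= !fctE hf hg.
Qed.

Variables (i : nat) (N : lmodType R).

Definition coboundary : {pred cocycles P i N} :=
  fun f => `[< is_coboundary (val f) >].

Fact coboundary_zmod_closed : zmod_closed coboundary.
Proof.
split=> [|f g /asboolP hf /asboolP hg]; apply/asboolP; first exact: is_coboundary0.
by rewrite raddfB; apply: is_coboundaryB.
Qed.
HB.instance Definition _ :=
  GRing.isZmodClosed.Build (cocycles P i N) coboundary coboundary_zmod_closed.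

Definition Ext : zmodType := Quotient.quot coboundary.

End Coboundary.

(* The Ext groups attached to two resolutions of M are isomorphic, so their   *)
(* vanishing is required for every resolution.                                *)
Definition Ext_eq0 (R : pzRingType) (i : nat) (M N : lmodType R) : Prop :=
  forall (P : proj_resolution M) (c : Ext P i N), c = 0.

Section Radical.
Variable R : pzRingType.

Definition right_ideal (I : set R) : Prop :=
  [/\ I 0, forall x y, I x -> I y -> I (x + y) & forall x a, I x -> I (x * a)].

Definition maximal_right_ideal (I : set R) : Prop :=
  [/\ right_ideal I, I <> setT &
      forall J, right_ideal J -> (I `<=` J)%classic -> J = I \/ J = setT].

Definition jrad : set R :=
  [set x | forall I, maximal_right_ideal I -> I x]%classic.

Lemma rad_right_ideal : right_ideal jrad.
Proof.
split=> [I [[]]|x y rx ry I mI|x a rx I mI] //; have [[_ hD hM] _ _] := mI.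
  by apply: hD; [exact: rx | exact: ry].
by apply: hM; exact: rx.
Qed.

End Radical.

(* A / rad A is isomorphic to k^n as a k-algebra, i.e., rad A is the kernel   *)
(* of a surjective k-algebra morphism A -> k^n.                               *)
Definition basic (k : fieldType) (A : falgType k) : Prop :=
  exists (n : nat) (phi : {rmorphism A -> {ffun 'I_n -> k}}),
    [/\ forall (a : k) (x : A) i, phi (a *: x) i = a * phi x i,
        forall y, exists x, phi x = y
      & forall x, phi x = 0 <-> jrad x].

Record idem (R : pzRingType) := Idem {
  idem_val :> R;
  idemP : idem_val * idem_val = idem_val
}.

Fact compl_idem_subproof (R : pzRingType) (e : idem R) :
  (1 - (e : R)) * (1 - (e : R)) = 1 - (e : R).
Proof. by rewrite mulrBr mulr1 mulrBl mul1r idemP subrr subr0. Qed.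

Definition compl_idem (R : pzRingType) (e : idem R) : idem R :=
  Idem (compl_idem_subproof e).

Definition primitive (R : pzRingType) (e : idem R) : Prop :=
  (e : R) <> 0 /\
  forall f g : idem R,
    (f : R) * (g : R) = 0 -> (g : R) * (f : R) = 0 ->
    (e : R) = (f : R) + (g : R) ->
    (f : R) = 0 \/ (g : R) = 0.

Section TopProjective.
Variables (R : pzRingType) (e : R).

Definition in_eR : {pred R} := fun x => `[< exists a, x = e * a >].

Fact in_eR_zmod_closed : zmod_closed in_eR.
Proof.
split=> [|x y /asboolP[a ->] /asboolP[b ->]]; apply/asboolP.
  by exists 0; rewrite mulr0.
by exists (a - b); rewrite mulrBr.
Qed.
HB.instance Definition _ := GRing.isZmodClosed.Build R in_eR in_eR_zmod_closed.

Definition eR := {x : R | x \in in_eR}.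
HB.instance Definition _ := SubChoice.on eR.
HB.instance Definition _ := [SubChoice_isSubZmodule of eR by <:].

Fact eR_act_subproof (a : R) (x : eR) : val x * a \in in_eR.
Proof.
by case: x => x /= /asboolP[b ->]; apply/asboolP; exists (b * a); rewrite mulrA.
Qed.
Definition eR_act (a : R^c) (x : eR) : eR := Sub (val x * a) (eR_act_subproof a x).

Fact eR_actA a b x : eR_act a (eR_act b x) = eR_act (a * b) x.
Proof. by apply: val_inj; rewrite /= -mulrA. Qed.
Fact eR_act1 : left_id 1 eR_act.
Proof. by move=> x; apply: val_inj; rewrite /= mulr1. Qed.
Fact eR_actDr : right_distributive eR_act +%R.
Proof. by move=> a x y; apply: val_inj; rewrite /= mulrDl. Qed.
Fact eR_actDl x : {morph eR_act^~ x : a b / a + b}.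
Proof. by move=> a b; apply: val_inj; rewrite /= mulrDr. Qed.
HB.instance Definition _ := GRing.Zmodule_isLmodule.Build R^c eR
  eR_actA eR_act1 eR_actDr eR_actDl.

Definition in_eradR : {pred eR} :=
  fun x => `[< exists2 r, jrad r & val x = e * r >].

Fact in_eradR_submod_closed : submod_closed in_eradR.
Proof.
have [h0 hD hM] := rad_right_ideal R.
split=> [|a x y /asboolP[r hr hx] /asboolP[s hs hy]]; apply/asboolP.
  by exists 0; rewrite // mulr0.
exists (r * a + s); first by apply: hD => //; apply: hM.
by rewrite /= hx hy mulrDr mulrA.
Qed.
Definition top_eR : lmodType R^c := quotmod in_eradR_submod_closed.

End TopProjective.

Section Peirce.
Variables (R : pzRingType) (e f : R).

Definition in_peirce : {pred R} := fun x => `[< exists a, x = e * a * f >].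

Fact in_peirce_zmod_closed : zmod_closed in_peirce.
Proof.
split=> [|x y /asboolP[a ->] /asboolP[b ->]]; apply/asboolP.
  by exists 0; rewrite mulr0 mul0r.
by exists (a - b); rewrite mulrBr mulrBl.
Qed.
HB.instance Definition _ :=
  GRing.isZmodClosed.Build R in_peirce in_peirce_zmod_closed.

End Peirce.

Section Corner.
Variables (R : pzRingType) (f : idem R).

Definition corner := {x : R | x \in in_peirce f f}.
HB.instance Definition _ := SubChoice.on corner.
HB.instance Definition _ := [SubChoice_isSubZmodule of corner by <:].

Fact corner_one_subproof : (f : R) \in in_peirce f f.
Proof. by apply/asboolP; exists (f : R); rewrite !idemP. Qed.
Definition corner_one : corner := Sub (f : R) corner_one_subproof.

Fact corner_mul_subproof (x y : corner) : val x * val y \in in_peirce f f.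
Proof.
case: x y => [x /= /asboolP[a ->]] [y /= /asboolP[b ->]]; apply/asboolP.
by exists (a * (f : R) * ((f : R) * b)); rewrite !mulrA.
Qed.
Definition corner_mul (x y : corner) : corner :=
  Sub (val x * val y) (corner_mul_subproof x y).

Fact corner_mulA : associative corner_mul.
Proof. by move=> x y z; apply: val_inj; rewrite /= mulrA. Qed.
Fact corner_mul1l : left_id corner_one corner_mul.
Proof.
by case=> x hx; apply: val_inj => /=; case/asboolP: hx => a ->; rewrite !mulrA idemP.
Qed.
Fact corner_mul1r : right_id corner_one corner_mul.
Proof.
by case=> x hx; apply: val_inj => /=; case/asboolP: hx => a ->; rewrite -mulrA idemP.
Qed.
Fact corner_mulDl : left_distributive corner_mul +%R.
Proof. by move=> x y z; apply: val_inj; rewrite /= mulrDl. Qed.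
Fact corner_mulDr : right_distributive corner_mul +%R.
Proof. by move=> x y z; apply: val_inj; rewrite /= mulrDr. Qed.
HB.instance Definition _ := GRing.Zmodule_isPzRing.Build corner
  corner_mulA corner_mul1l corner_mul1r corner_mulDl corner_mulDr.

End Corner.

Section PeirceModule.
Variables (R : pzRingType) (e : R) (f : idem R).
Local Notation corner := (corner f).

Definition eRf := {x : R | x \in in_peirce e f}.
HB.instance Definition _ := SubChoice.on eRf.
HB.instance Definition _ := [SubChoice_isSubZmodule of eRf by <:].

Fact eRf_act_subproof (a : corner) (x : eRf) : val x * val a \in in_peirce e f.
Proof.
case: a x => [a /= /asboolP[b ->]] [x /= /asboolP[c ->]]; apply/asboolP.
by exists (c * (f : R) * ((f : R) * b)); rewrite !mulrA.
Qed.
Definition eRf_act (a : corner^c) (x : eRf) : eRf :=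
  Sub (val x * val (a : corner)) (eRf_act_subproof a x).

Fact eRf_actA a b x : eRf_act a (eRf_act b x) = eRf_act (a * b) x.
Proof. by apply: val_inj; rewrite /= -mulrA. Qed.
Fact eRf_act1 : left_id 1 eRf_act.
Proof.
by case=> x hx; apply: val_inj => /=; case/asboolP: hx => a ->; rewrite -mulrA idemP.
Qed.
Fact eRf_actDr : right_distributive eRf_act +%R.
Proof. by move=> a x y; apply: val_inj; rewrite /= mulrDl. Qed.
Fact eRf_actDl x : {morph eRf_act^~ x : a b / a + b}.
Proof. by move=> a b; apply: val_inj; rewrite /= mulrDr. Qed.
HB.instance Definition _ := GRing.Zmodule_isLmodule.Build corner^c eRf
  eRf_actA eRf_act1 eRf_actDr eRf_actDl.

End PeirceModule.

(* Main.v *)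
From HB Require Import structures.
Require Import Defs.
From mathcomp Require Import all_boot all_order all_algebra all_field.
From mathcomp Require Import boolp classical_sets functions.

(** Write f = 1 - e, Gamma = fAf and S = S_e, and suppose that Ext^i(S, S) is
nonzero for some i > 0.  As S has finite projective dimension there is a largest
such index m >= 1.  A basic finite dimensional algebra has a nilpotent radical,
and S is one-dimensional because e is primitive, so every right A-module M with
Mf = 0 has a finite filtration whose layers are direct sums of copies of S.  Hence
Ext^j(M, S) = 0 for j > m ([ext_vanish_fnull]), and Ext^m(M, S) = 0 forces M = 0,
since S embeds in any nonzero M and Ext^m(-, S) turns injections between such
modules into surjections ([fnull_trivial]).

Let P be a projective resolution of the Gamma-module eAf of finite length.
Starting from Z_0 = eA one builds A-modules Z_i, with a Gamma-linear map from P_i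
onto Z_i f whose kernel is the image of P_(i+1), as follows: Z_(i+1) is the kernel
of the induced map X_i -> Z_i, where X_i is the projective A-module obtained from
P_i by tensoring with fA over Gamma.  The image B_i of this map is the submodule
Z_i fA, and H_i = Z_i / B_i satisfies H_i f = 0.  All Ext^j(X_i, S) vanish,
j = 0 included, because Sf = 0.  So the long exact sequences show that the
vanishing of Ext^j(Z_i, S) for all j >= m passes from Z_i to Z_(i+1).  In the other
direction, if Ext^j(Z_(i+1), S) = 0 for all j >= 0, then the same holds for B_i,
whence Ext^m(H_i, S) = 0, H_i = 0 and Z_i = B_i.  For large i one has
P_i = 0, so Z_i f = 0, and Ext^m(Z_i, S) = 0 gives Z_i = 0.  Descending induction on i
([corner_resolution_vanish]) gives Hom(eA, S) = 0, which is absurd.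

The groups Ext^j(-, S) enter only through their vanishing, expressed by means of
an injective coresolution of S (coinduced modules provide enough injectives); with
this definition the three consequences of the long exact sequence that are needed
are short diagram chases, and the comparison with arbitrary projective
resolutions is dimension shifting. *)

Set Implicit Arguments.
Unset Strict Implicit.
Unset Printing Implicit Defensive.
Import GRing.Theory.
Local Open Scope quotient_scope.
Local Open Scope classical_set_scope.
Local Open Scope ring_scope.

(** * Linear maps, short exact sequences and submodules *)

Section LinearMaps.
Variable R : pzRingType.
Implicit Types K M N Q T : lmodType R.

Lemma linear_map_exists M N (f : M -> N) :
  linear f -> exists g : {linear M -> N}, g =1 f.
Proof.
move=> lf.
pose g : {linear M -> N} := HB.pack f (GRing.isLinear.Build R M N *:%R f lf).
by exists g.
Qed.

(** A linear map that kills the kernel of a surjection factors through it. *)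
Lemma factor_surj M Q T (p : {linear M -> Q}) (g : {linear M -> T}) :
  (forall y, exists x, p x = y) -> (forall x, p x = 0 -> g x = 0) ->
  exists h : {linear Q -> T}, forall x, h (p x) = g x.
Proof.
move=> /choice[s ps] gp.
have gE x y : p x = p y -> g x = g y.
  by move=> e; apply/subr0_eq; rewrite -linearB; apply: gp; rewrite linearB e subrr.
have [h hE] : exists h : {linear Q -> T}, h =1 g \o s.
  apply: linear_map_exists => a x y /=; rewrite -linearP; apply: gE.
  by rewrite linearP !ps.
by exists h => x; rewrite hE; apply: gE.
Qed.

(** A linear map with values in the image of an injection factors through it. *)
Lemma factor_inj M N T (i : {linear T -> N}) (g : {linear M -> N}) :
  injective i -> (forall x, exists t, i t = g x) ->
  exists h : {linear M -> T}, forall x, i (h x) = g x.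
Proof.
move=> inji /choice[s si].
have [h hE] : exists h : {linear M -> T}, h =1 s.
  by apply: linear_map_exists => a x y; apply: inji; rewrite linearP !si linearP.
by exists h => x; rewrite hE.
Qed.

Definition trivial_mod M := forall x : M, x = 0.

(** Injective modules, by the extension property along injective linear maps. *)
Definition injective_mod (J : lmodType R) :=
  forall M N (i : {linear M -> N}) (g : {linear M -> J}), injective i ->
    exists h : {linear N -> J}, forall x, h (i x) = g x.

(** Short exact sequences 0 -> K -> M -> Q -> 0. *)
Record ses K M Q (i : {linear K -> M}) (p : {linear M -> Q}) : Prop := Ses {
  ses_inj : injective i;
  ses_surj : forall y, exists x, p x = y;
  ses_exact : forall x, p x = 0 <-> exists y, i y = x
}.

Lemma linear_injective0 M N (i : {linear M -> N}) :
  (forall x, i x = 0 -> x = 0) -> injective i.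
Proof. by move=> i0 x y e; apply/subr0_eq/i0; rewrite linearB e subrr. Qed.

End LinearMaps.

Section Submodule.
Variables (R : pzRingType) (M : lmodType R) (N : {pred M}).
Hypothesis N_submod : submod_closed N.

(** The submodule carried by a predicate; the closure proof is an argument so that
the module structure can be inferred from the type. *)
Definition submod (_ : submod_closed N) := {x : M | x \in N}.
Local Notation SM := (submod N_submod).
HB.instance Definition _ := SubChoice.on SM.
#[local] HB.instance Definition _ := GRing.isSubmodClosed.Build R M N
  (GRing.submod_closed_semi N_submod).
#[local] HB.instance Definition _ := GRing.isZmodClosed.Build M N
  (GRing.submod_closedB N_submod).
HB.instance Definition _ := [SubChoice_isSubZmodule of SM by <:].
HB.instance Definition _ := [SubZmodule_isSubLmodule of SM by <:].

Lemma submod_val : exists i : {linear SM -> M}, i =1 val.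
Proof. by exists (val : {linear SM -> M}). Qed.

End Submodule.

Section SubQuot.
Variable R : pzRingType.
Implicit Types K M N Q T : lmodType R.

Lemma submodule_ses M (N : M -> Prop) :
  N 0 -> (forall a x y, N x -> N y -> N (a *: x + y)) ->
  exists (K Q : lmodType R) (i : {linear K -> M}) (p : {linear M -> Q}),
    ses i p /\ forall x, N x <-> exists y, i y = x.
Proof.
move=> N0 ND; pose Nb : {pred M} := fun x => `[< N x >].
have NS : submod_closed Nb.
  by split=> [|a x y /asboolP hx /asboolP hy]; apply/asboolP; [|apply: ND].
have [i iE] := submod_val NS.
have [p pE] : exists p : {linear M -> quotmod NS}, p =1 quotmod_pi NS.
  apply: linear_map_exists => a x y.
  by rewrite quotmod_piD -quotmod_piZ.
have NE x : N x <-> exists y, i y = x.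
  split=> [Nx|[y <-]].
    have Nx' : x \in Nb by apply/asboolP.
    by exists (Sub x Nx' : submod NS); rewrite iE SubK.
  by apply/asboolP; rewrite iE; apply: (valP y).
exists (submod NS), (quotmod NS), i, p; split => //; split.
- by move=> x y; rewrite !iE => /val_inj.
- by move=> y; have [x <-] := quotmod_piP y; exists x; rewrite pE.
move=> x; rewrite -NE pE.
have -> : 0 = quotmod_pi NS 0 by rewrite -pE linear0.
by rewrite quotmod_pi_eq subr0; split=> [/asboolP|/asboolP].
Qed.

(** The factorization of a linear map g as a surjection p onto its image B followed
by an injection j, with its kernel K. *)
Lemma kernel_ses M N (g : {linear M -> N}) :
  exists (K B : lmodType R) (i : {linear K -> M}) (p : {linear M -> B}) (j : {linear B -> N}),
    [/\ ses i p, injective j, (forall x, j (p x) = g x) &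
        forall x, g x = 0 <-> exists y, i y = x].
Proof.
have [||K [B [i [p [sip gE]]]]] := @submodule_ses M (fun x => g x = 0).
- exact: linear0.
- by move=> a x y gx gy; rewrite linearP gx gy scaler0 addr0.
have [|j jE] := factor_surj (p := p) (g := g) (ses_surj sip).
  by move=> x /(ses_exact sip)/gE.
exists K, B, i, p, j; split=> //.
apply: linear_injective0 => y; have [x <-] := ses_surj sip y.
by rewrite jE => /gE/(ses_exact sip).
Qed.

Lemma cokernel_ses K M (i : {linear K -> M}) : injective i ->
  exists (Q : lmodType R) (p : {linear M -> Q}), ses i p.
Proof.
move=> inji.
have [||K' [Q [i' [p [sip iE]]]]] := @submodule_ses M (fun x => exists y, i y = x).
- by exists 0; exact: linear0.
- by move=> a x y [x' <-] [y' <-]; exists (a *: x' + y'); rewrite linearP.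
exists Q, p; split=> //; first exact: ses_surj sip.
by move=> x; rewrite iE; exact: ses_exact sip x.
Qed.

End SubQuot.

(** * Vanishing of Ext along an injective coresolution *)

(** An injective coresolution of [cos_T 0], cut into short exact sequences
0 -> T_j -> J_(j+1) -> T_(j+1) -> 0.  The injectives are shifted by one so that
J_j maps to T_j for every j; this makes J_0 = 0 the uniform starting value. *)
Record coresolution (R : pzRingType) := Coresolution {
  cos_T : nat -> lmodType R;
  cos_J : nat -> lmodType R;
  cos_pi : forall j, {linear cos_J j -> cos_T j};
  cos_iota : forall j, {linear cos_T j -> cos_J j.+1};
  cos_J0 : trivial_mod (cos_J 0);
  cos_J_inj : forall j, injective_mod (cos_J j);
  cos_ses : forall j, ses (cos_iota j) (cos_pi j.+1)
}.

Section ExtVanish.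
Variables (R : pzRingType) (C : coresolution R).
Local Notation S := (cos_T C 0).
Local Notation T := (cos_T C).
Local Notation J := (cos_J C).
Local Notation pi := (cos_pi C).
Local Notation iota := (cos_iota C).
Implicit Types K M N Q : lmodType R.

(** Ext^j(M, S) = 0, where S = T_0: every map from M to T_j lifts to J_j.  For
j > 0 this is the vanishing of Ext^j computed with the coresolution; for j = 0 it
says that Hom(M, S) = 0, because J_0 = 0. *)
Definition ext_vanish j M :=
  forall g : {linear M -> T j}, exists h : {linear M -> J j}, forall x, pi j (h x) = g x.
Local Notation V := ext_vanish.

Section LES.
Variables (K M Q : lmodType R) (i : {linear K -> M}) (p : {linear M -> Q}).
Hypothesis ip : ses i p.

Lemma ses_comp x : p (i x) = 0.
Proof. by apply/(ses_exact ip); exists x. Qed.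

Lemma ext_vanish_ext j : V j K -> V j Q -> V j M.
Proof.
move=> VK VQ g.
have [h hE] := VK (g \o i).
have [h' h'E] := cos_J_inj h (ses_inj ip).
have [|u uE] := factor_surj (p := p) (g := g \- (pi j \o h')) (ses_surj ip).
  by move=> x /(ses_exact ip)[y <-]; rewrite /= h'E hE subrr.
have [v vE] := VQ u.
exists (h' \+ (v \o p)) => x /=.
by rewrite linearD vE uE /= addrC subrK.
Qed.

(** The connecting map Ext^j(K, S) -> Ext^(j+1)(Q, S) in terms of T_j: when its
target vanishes, maps from K to T_j extend to M. *)
Lemma ext_vanish_extend j (g : {linear K -> T j}) : V j.+1 Q ->
  exists h : {linear M -> T j}, forall x, h (i x) = g x.
Proof.
move=> VQ.
have [h hE] := cos_J_inj (iota j \o g) (ses_inj ip).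
have [|u uE] := factor_surj (p := p) (g := pi j.+1 \o h) (ses_surj ip).
  move=> x /(ses_exact ip)[y <-]; rewrite /= hE /=.
  by apply/(ses_exact (cos_ses C j)); exists (g y).
have [v vE] := VQ u.
have [|w wE] := factor_inj (g := h \- (v \o p)) (ses_inj (cos_ses C j)).
  move=> x; apply/(ses_exact (cos_ses C j)).
  by rewrite /= linearB vE uE subrr.
exists w => x; apply: (ses_inj (cos_ses C j)).
by rewrite wE /= ses_comp linear0 subr0 hE.
Qed.

Lemma ext_vanish_sub j : V j M -> V j.+1 Q -> V j K.
Proof.
move=> VM VQ g; have [g' g'E] := ext_vanish_extend g VQ.
have [h hE] := VM g'.
by exists (h \o i) => x /=; rewrite hE g'E.
Qed.

Lemma ext_vanish_quot j : V j K -> V j.+1 M -> V j.+1 Q.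
Proof.
move=> VK VM g; have [h hE] := VM (g \o p).
have [|k kE] := factor_inj (g := h \o i) (ses_inj (cos_ses C j)).
  move=> x; apply/(ses_exact (cos_ses C j)).
  by rewrite hE /= ses_comp linear0.
have [l lE] := VK k.
(* Correcting h by a map with values in T_j does not change its image in T_(j+1). *)
have [l' l'E] := cos_J_inj l (ses_inj ip).
have [|u uE] := factor_surj (p := p) (g := h \- (iota j \o pi j \o l')) (ses_surj ip).
  by move=> x /(ses_exact ip)[y <-]; rewrite /= l'E lE kE subrr.
exists u => y; have [x <-] := ses_surj ip y.
rewrite uE /= linearB hE /=.
have /(ses_exact (cos_ses C j)) -> : exists t, iota j t = iota j (pi j (l' x)).
  by exists (pi j (l' x)).
by rewrite subr0.
Qed.

End LES.

Lemma ext_vanish_trivial j M : trivial_mod M -> V j M.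
Proof.
by move=> M0 g; exists (\0 : {linear M -> J j}) => x; rewrite [x]M0 !linear0.
Qed.

Lemma ext_vanish_projective j M : projective M -> V j.+1 M.
Proof. by move=> PM g; apply: PM => y; apply: (ses_surj (cos_ses C j)). Qed.

Lemma ext_vanish0 M :
  (forall g : {linear M -> S}, forall x, g x = 0) <-> V 0 M.
Proof.
split=> [M0 g|VM g x].
  by exists (\0 : {linear M -> J 0}) => x; rewrite M0 linear0.
by have [h <-] := VM g; rewrite [h x]cos_J0 linear0.
Qed.

Section Resolution.
Variables (M : lmodType R) (P : proj_resolution M).

(** K is the n-th syzygy of the resolution: p identifies K with the cokernel of the
differential P_(n+1) -> P_n. *)
Definition covers n K (p : {linear P n -> K}) :=
  (forall y, exists x, p x = y) /\
  (forall x, p x = 0 <-> exists y, res_d P n y = x).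

Lemma syzygy n K (p : {linear P n -> K}) : covers p ->
  exists (K' : lmodType R) (i : {linear K' -> P n}) (p' : {linear P n.+1 -> K'}),
    [/\ ses i p, covers p' & forall x, i (p' x) = res_d P n x].
Proof.
move=> [sp kp].
have [K' [B [i [q [j [siq injj jq iE]]]]]] := kernel_ses p.
have [|p' p'E] := factor_inj (g := res_d P n) (ses_inj siq).
  by move=> x; apply/iE/kp; exists x.
exists K', i, p'; split=> //; first by split=> //; exact: ses_inj siq.
split=> [y|x].
  have /kp[x xE] : p (i y) = 0 by apply/iE; exists y.
  by exists x; apply: (ses_inj siq); rewrite p'E xE.
split=> [e|/res_exact e]; first by apply/res_exact; rewrite -p'E e linear0.
by move: e; rewrite -p'E => e; apply: (ses_inj siq); rewrite e linear0.
Qed.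

(** Ext^j of the n-th syzygy vanishes when n + j exceeds the length l. *)
Lemma ext_vanish_length l n j K (p : {linear P n -> K}) :
  (forall i, (l < i)%N -> trivial_mod (P i)) -> covers p -> (l < n + j)%N -> V j K.
Proof.
move=> P0; elim: j => [|j IH] in n K p *.
  rewrite addn0 => -[sp _] /P0 Pn0; apply: ext_vanish_trivial => y.
  by have [x <-] := sp y; rewrite [x]Pn0 linear0.
move=> /syzygy[K' [i [p' [sip cp' _]]]]; rewrite addnS -addSn => ln.
apply: (ext_vanish_quot sip); first exact: IH cp' ln.
by apply: ext_vanish_projective; apply: res_proj.
Qed.

(** If Ext^(j+1) of the n-th syzygy vanishes, then every cocycle of degree n + j + 1
with values in S is a coboundary.  The degree is named m to keep the types of g
and h free of casts. *)
Lemma ext_vanish_cocycle n m j K (p : {linear P n -> K}) :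
  covers p -> V j.+1 K -> (n + j)%N = m ->
  forall g : {linear P m.+1 -> T 0}, (forall x, g (res_d P m.+1 x) = 0) ->
  exists h : {linear P m -> T 0}, forall x, h (res_d P m x) = g x.
Proof.
elim: j => [|j IH] in n K p *.
  move=> /syzygy[K' [i [p' [sip [sp' kp'] ip']]]] VK.
  rewrite addn0 => <- g g0.
  have [|u uE] := factor_surj (p := p') (g := g) sp'.
    by move=> x /kp'[y <-].
  have [h hE] := ext_vanish_extend sip u VK.
  by exists h => x; rewrite -ip' hE uE.
move=> /syzygy[K' [i [p' [sip cp' _]]]] VK; rewrite addnS -addSn.
apply: IH cp' _; apply: (ext_vanish_sub sip _ VK).
by apply: ext_vanish_projective; apply: res_proj.
Qed.

Lemma covers_aug : covers (res_aug P).
Proof. by split; [apply: res_aug_surj | apply: res_aug_exact]. Qed.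

End Resolution.

Lemma pd_finite_ext_vanish M : pd_finite M ->
  exists l, forall j, (l < j)%N -> V j M.
Proof.
move=> [l [P P0]]; exists l => j lj.
exact: (ext_vanish_length P0 (covers_aug P)).
Qed.

Lemma ext_vanish_Ext_eq0 M j : V j.+1 M -> Ext_eq0 j.+1 M S.
Proof.
move=> VM P c.
have key (f : P j.+1 -> S) : linear f -> (forall x, f (res_d P j.+1 x) = 0) ->
    is_coboundary (P := P) f.
  rewrite /= => /linear_map_exists[f' f'E] f0.
  have := @ext_vanish_cocycle M P 0 j j M (res_aug P) (covers_aug P) VM erefl.
  move=> /(_ f')[x|h hE]; first by rewrite f'E f0.
  by exists h => x; rewrite hE f'E.
rewrite -[c]reprK.
case: (repr c) => f hf.
have -> : (0 : Ext P j.+1 S) = \pi_(Ext P j.+1 S) 0 by rewrite raddf0.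
apply/eqmodP; rewrite /= Quotient.equivE subr0.
apply/asboolP; have /asboolP[lf f0] := hf.
exact: key.
Qed.

End ExtVanish.

(** * Vector spaces of arbitrary dimension *)

Section VectorSpaces.
Variable k : fieldType.
Implicit Types U V W : lmodType k.

(** Every subspace K is the image of a linear projection, by Zorn's lemma. *)
Lemma complement V (K : set V) :
  K 0 -> (forall a x y, K x -> K y -> K (a *: x + y)) ->
  exists rho : {linear V -> V}, (forall x, K (rho x)) /\ (forall x, K x -> rho x = x).
Proof.
move=> K0 KD.
(* The subspaces meeting K trivially, and the empty set, the union of the empty chain. *)
pose P (C : set V) := (forall a x y, C x -> C y -> C (a *: x + y)) /\
  (forall x, C x -> K x -> x = 0).
have [F FP Ftot|C [[CD CK] Cmax]] := @Zorn_bigcup V P.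
  split=> [a x y [B FB Bx] [B' FB' B'y]|x [B FB Bx]]; last exact: (FP _ FB).2.
  have [BB'|B'B] := Ftot _ _ FB FB'.
    by exists B' => //; apply: (FP _ FB').1 => //; apply: BB'.
  by exists B => //; apply: (FP _ FB).1 => //; apply: B'B.
have C0 : C 0.
  apply: contrapT => nC0; apply: (Cmax [set 0]); first split.
  - by move=> x Cx; case: nC0; rewrite -(addNr x) -scaleN1r; apply: CD.
  - by move=> /(_ 0 erefl).
  split=> [a x y -> ->|x -> //]; by rewrite /= scaler0 addr0.
have CZ a x : C x -> C (a *: x) by move=> Cx; rewrite -[_ *: _]addr0; apply: CD.
have KZ a x : K x -> K (a *: x) by move=> Kx; rewrite -[_ *: _]addr0; apply: KD.
have KC x : exists u, K u /\ C (x - u).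
  apply: contrapT => nx.
  pose D := [set y | exists c u, [/\ C c & y = c + u *: x]].
  apply: (Cmax D); first split.
  - by move=> c Cc; exists c, 0; rewrite scale0r addr0.
  - move=> DC; case: nx; exists 0; split=> //; rewrite subr0; apply: DC.
    by exists 0, 1; rewrite scale1r add0r.
  split=> [a y z [c [u [Cc ->]]] [d [v [Cd ->]]]|y [c [u [Cc yE]]] Ky].
    exists (a *: c + d), (a * u + v); split; first exact: CD.
    by rewrite scalerDr scalerA scalerDl addrACA.
  have [u0|u0] := eqVneq u 0.
    by apply: CK => //; rewrite yE u0 scale0r addr0.
  case: nx; exists (u^-1 *: y); split; first exact: KZ.
  rewrite yE scalerDr scalerA mulVf // scale1r opprD addrCA subrr addr0.
  by rewrite -scalerN -[- c]scaleN1r; apply: (CZ); apply: CZ.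
have [r rE] := choice KC.
have runiq x u : K u -> C (x - u) -> r x = u.
  have [Kr Cr] := rE x; move=> Ku Cu; apply/subr0_eq/CK.
    have -> : r x - u = (-1) *: (x - r x) + (x - u).
      by rewrite scaleN1r opprB addrA subrK.
    exact: CD.
  by rewrite addrC -scaleN1r; apply: KD.
have [rho rhoE] : exists rho : {linear V -> V}, rho =1 r.
  apply: linear_map_exists => a x y; have [Kx Cx] := rE x; have [Ky Cy] := rE y.
  apply: runiq; first exact: KD.
  by rewrite opprD addrACA -scalerBr; apply: CD.
exists rho; split=> x; rewrite rhoE; first exact: (rE x).1.
by move=> Kx; apply: runiq => //; rewrite subrr.
Qed.

(** Vector spaces are injective. *)
Lemma vectspace_extend U V W (i : {linear U -> V}) (g : {linear U -> W}) : injective i ->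
  exists h : {linear V -> W}, forall x, h (i x) = g x.
Proof.
move=> inji.
have [||rho [rhoK rhoid]] := @complement V [set y | exists x, i x = y].
- by exists 0; exact: linear0.
- by move=> a x y [x' <-] [y' <-]; exists (a *: x' + y'); rewrite linearP.
have [r rE] := factor_inj inji rhoK.
exists (g \o r) => x /=; congr (g _); apply: inji; rewrite rE; apply: rhoid.
by exists x.
Qed.

(** Vector spaces are projective, in a form relative to a subspace D: if each h u is
the image of an element of D, then h lifts to a linear map with values in D. *)
Lemma vectspace_lift U V W (p : {linear V -> W}) (h : {linear U -> W}) (D : set V) :
  D 0 -> (forall a x y, D x -> D y -> D (a *: x + y)) ->
  (forall u, exists v, D v /\ p v = h u) ->
  exists s : {linear U -> V}, forall u, D (s u) /\ p (s u) = h u.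
Proof.
move=> D0 DD /choice[l lE].
have [||rho [rhoK rhoid]] := @complement V [set y | D y /\ p y = 0].
- by split=> //; exact: linear0.
- move=> a x y [Dx px] [Dy py]; split; first exact: DD.
  by rewrite linearP px py scaler0 addr0.
have DB x y : D x -> D y -> D (x - y).
  by move=> Dx Dy; rewrite addrC -scaleN1r; apply: DD.
have [s sE] : exists s : {linear U -> V}, s =1 (fun u => l u - rho (l u)).
  apply: linear_map_exists => a x y.
  set z := l _; pose w := a *: l x + l y.
  have -> : a *: (l x - rho (l x)) + (l y - rho (l y)) = w - rho w.
    by rewrite /w linearP scalerBr opprD addrACA.
  apply/subr0_eq; rewrite opprD addrACA -opprD -linearB.
  rewrite [rho (z - w)]rhoid ?subrr //; split.
    by apply: (DB); [exact: (lE _).1 | apply: DD; exact: (lE _).1].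
  by rewrite linearB linearP /z !(lE _).2 linearP subrr.
exists s => u; rewrite sE; have [[Dr pr] [Dl pl]] := (rhoK (l u), lE u).
by split; [apply: DB | rewrite linearB pr subr0].
Qed.

End VectorSpaces.

(** * Coinduced modules and existence of coresolutions *)

(** The right action of a on an element x of a right module. *)
Notation "x •> a" := ((a : _^c) *: x) (at level 40, left associativity) : ring_scope.

Section RightModules.
Variables (A : pzRingType).
Implicit Types M N : lmodType A^c.

Lemma ractA M (x : M) (a b : A) : x •> a •> b = x •> (a * b).
Proof. by rewrite scalerA. Qed.

End RightModules.

Section Restriction.
Variables (k : fieldType) (A : algType k).
Implicit Types M N : lmodType A^c.

(** The k-vector space underlying a right module over a k-algebra A. *)
Definition kmod (M : lmodType A^c) : Type := M.
HB.instance Definition _ M := GRing.Zmodule.on (kmod M).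

Section Instance.
Variable M : lmodType A^c.
Definition kmod_scale (c : k) (x : kmod M) : kmod M := (x : M) •> (c%:A : A).
Fact kmod_scaleA a b x : kmod_scale a (kmod_scale b x) = kmod_scale (a * b) x.
Proof. by rewrite /kmod_scale ractA -scalerAl mul1r scalerA mulrC. Qed.
Fact kmod_scale1 : left_id 1 kmod_scale.
Proof. by move=> x; rewrite /kmod_scale !scale1r. Qed.
Fact kmod_scaleDr : right_distributive kmod_scale +%R.
Proof. by move=> a x y; rewrite /kmod_scale scalerDr. Qed.
Fact kmod_scaleDl x : {morph kmod_scale^~ x : a b / a + b}.
Proof. by move=> a b; rewrite /kmod_scale [(a + b)%:A]scalerDl -[RHS]scalerDl. Qed.
HB.instance Definition _ := GRing.Zmodule_isLmodule.Build k (kmod M)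
  kmod_scaleA kmod_scale1 kmod_scaleDr kmod_scaleDl.
End Instance.

Lemma kmodZ M (c : k) (x : M) : c *: (x : kmod M) = x •> (c%:A : A).
Proof. by []. Qed.

Lemma kmod_linear M N (f : {linear M -> N}) :
  exists g : {linear kmod M -> kmod N}, forall x, g x = f x.
Proof.
by apply: linear_map_exists => c x y; rewrite kmodZ linearP.
Qed.

End Restriction.

Section Coinduced.
Variables (k : fieldType) (A : algType k) (V : lmodType k).

(** The coinduced right A-module Hom_k(A, V), with (phi a)(b) = phi (a b). *)
Definition coind_pred : {pred A -> V} := fun f => `[< linear f >].
Fact coind_zmod_closed : zmod_closed coind_pred.
Proof.
split=> [|f g /asboolP lf /asboolP lg]; apply/asboolP => a x y.
  by rewrite /= scaler0 addr0.
by rewrite !fctE lf lg scalerBr opprD addrACA.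
Qed.
HB.instance Definition _ := GRing.isZmodClosed.Build (A -> V) coind_pred coind_zmod_closed.

Definition coind := {f : A -> V | f \in coind_pred}.
HB.instance Definition _ := SubChoice.on coind.
HB.instance Definition _ := [SubChoice_isSubZmodule of coind by <:].

Fact coind_act_subproof (a : A) (f : coind) : (fun b => val f (a * b)) \in coind_pred.
Proof.
apply/asboolP => c x y; have /asboolP lf := valP f.
by rewrite mulrDr -scalerAr lf.
Qed.
Definition coind_act (a : A^c) (f : coind) : coind :=
  Sub (fun b => val f ((a : A) * b)) (coind_act_subproof a f).

Lemma coindP (f : coind) : linear (val f).
Proof. by have /asboolP := valP f. Qed.
Lemma coind_valD (f : coind) a b : val f (a + b) = val f a + val f b.
Proof. by rewrite -[a]scale1r coindP !scale1r. Qed.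
Lemma coind_valZ (f : coind) c a : val f (c *: a) = c *: val f a.
Proof.
have val0 : val f 0 = 0.
  by apply: (addrI (val f 0)); rewrite -coind_valD !addr0.
by rewrite -[c *: a]addr0 coindP val0 addr0.
Qed.
Lemma coindD (f g : coind) a : val (f + g) a = val f a + val g a. Proof. by []. Qed.

Fact coind_actA a b x : coind_act a (coind_act b x) = coind_act (a * b) x.
Proof. by apply: val_inj; apply/funext => c; rewrite /= mulrA. Qed.
Fact coind_act1 : left_id 1 coind_act.
Proof. by move=> x; apply: val_inj; apply/funext => c; rewrite /= mul1r. Qed.
Fact coind_actDr : right_distributive coind_act +%R.
Proof. by move=> a x y; apply: val_inj; apply/funext => c. Qed.
Fact coind_actDl x : {morph coind_act^~ x : a b / a + b}.
Proof.
move=> a b; apply: val_inj; apply/funext => c /=.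
by rewrite !fctE mulrDl; apply: coind_valD.
Qed.
HB.instance Definition _ := GRing.Zmodule_isLmodule.Build A^c coind
  coind_actA coind_act1 coind_actDr coind_actDl.

Lemma coindZ (f : coind) (a b : A) : val (f •> a) b = val f (a * b). Proof. by []. Qed.

(** The adjunction Hom_k(M, V) -> Hom_A(M, Hom_k(A, V)). *)
Lemma coind_lift (M : lmodType A^c) (g : {linear kmod M -> V}) :
  exists h : {linear M -> coind}, forall x a, val (h x) a = g (x •> a).
Proof.
have lg (x : M) : (fun a => g (x •> a)) \in coind_pred.
  apply/asboolP => c a b.
  rewrite -linearP; congr (g _); rewrite kmodZ ractA scalerDl; congr (_ + _).
  by rewrite -scalerAr mulr1.
have [h hE] : exists h : {linear M -> coind},
    h =1 (fun x => Sub (fun a => g (x •> a)) (lg x) : coind).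
  apply: linear_map_exists => a x y; apply: val_inj; apply/funext => b.
  by rewrite coindD coindZ /= scalerDr linearD ractA.
by exists h => x a; rewrite hE.
Qed.

Lemma coind_injective : injective_mod (coind : lmodType A^c).
Proof.
move=> M N i g inji.
have [g1 g1E] : exists g1 : {linear kmod M -> V}, g1 =1 (fun x => val (g x) 1).
  apply: linear_map_exists => c x y; rewrite kmodZ linearP coindD coindZ mulr1; congr (_ + _).
  exact: coind_valZ.
have [i' i'E] := kmod_linear i.
have [|h1 h1E] := vectspace_extend (i := i') g1; first by move=> x y; rewrite !i'E => /inji.
have [h hE] := coind_lift h1.
exists h => x; apply: val_inj; apply/funext => a.
rewrite hE -linearZ /= -i'E h1E g1E linearZ.
by rewrite coindZ mulr1.
Qed.

End Coinduced.

Section CoindResolution.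
Variables (k : fieldType) (A : algType k).

(** There are enough injectives: x maps to the function a |-> x a. *)
Lemma coind_embed (M : lmodType A^c) :
  exists (h : {linear M -> coind A (kmod M)}), injective h.
Proof.
have [h hE] := @coind_lift k A _ M (idfun : {linear kmod M -> kmod M}).
exists h => x y e; move: (hE x 1) (hE y 1).
by rewrite e !scale1r => ->.
Qed.

Lemma zero_mod_exists (R : pzRingType) : exists M : lmodType R, trivial_mod M.
Proof. by exists 'rV[R]_0 => x; apply: thinmx0. Qed.

Lemma coresolution_exists (S : lmodType A^c) :
  exists C : coresolution A^c, cos_T C 0%N = S.
Proof.
pose step (M : lmodType A^c) (JQ : lmodType A^c * lmodType A^c) :=
  injective_mod JQ.1 /\ exists (i : {linear M -> JQ.1}) (p : {linear JQ.1 -> JQ.2}), ses i p.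
have /choice[F FE] : forall M, exists JQ, step M JQ.
  move=> M; have [i inji] := coind_embed M; have [Q [p ip]] := cokernel_ses inji.
  exists (coind A (kmod M) : lmodType A^c, Q); split; first exact: coind_injective.
  by exists i, p.
have [Z Z0] := zero_mod_exists A^c.
pose T j := iter j (fun M => (F M).2) S.
pose J j := if j is j'.+1 then (F (T j')).1 else Z.
have ex j : exists ip : {linear T j -> J j.+1} * {linear J j.+1 -> T j.+1}, ses ip.1 ip.2.
  by have [_ [i [p sip]]] := FE (T j); exists (i, p).
pose G j := projT1 (cid (ex j)); pose GE j : ses (G j).1 (G j).2 := projT2 (cid (ex j)).
pose pi j : {linear J j -> T j} := if j is j'.+1 then (G j').2 else \0.
have Jinj j : injective_mod (J j).
  case: j => [|j]; last exact: (FE (T j)).1.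
  move=> M N i g _; exists (\0 : {linear N -> J 0%N}) => x.
  by rewrite [LHS]Z0 [RHS]Z0.
by exists (@Coresolution A^c T J pi (fun j => (G j).1) Z0 Jinj GE).
Qed.
End CoindResolution.

(** * Modules over a corner ring and induction to the whole ring *)

Section CornerModules.
Variables (A : pzRingType) (fi : idem A).
Local Notation f := (idem_val fi).
Local Notation G := (corner fi).

Fact corner_of_subproof (a : A) : f * a * f \in in_peirce f f.
Proof. by apply/asboolP; exists a. Qed.
(** The element faf of the corner ring fAf. *)
Definition corner_of (a : A) : G := Sub (f * a * f) (corner_of_subproof a).

Lemma val_corner_of a : val (corner_of a) = f * a * f. Proof. by []. Qed.
Lemma val_cornerM (x y : G) : val (x * y) = val x * val y. Proof. by []. Qed.
Lemma val_cornerD (x y : G) : val (x + y) = val x + val y. Proof. by []. Qed.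
Lemma corner_fl (x : G) : f * val x = val x.
Proof. exact: (congr1 val (mul1r x)). Qed.
Lemma corner_fr (x : G) : val x * f = val x.
Proof. exact: (congr1 val (mulr1 x)). Qed.

(** Linearity over fAf of a map from an fAf-module Q to an A-module M.  As f is the
unit of fAf, the values of such a map lie in Mf. *)
Definition corner_linear (Q : lmodType G^c) (M : lmodType A^c) (phi : Q -> M) :=
  (forall q q', phi (q + q') = phi q + phi q') /\
  (forall (g : G) q, phi (q •> g) = phi q •> val g).

Section CornerLinear.
Variables (Q : lmodType G^c) (M : lmodType A^c) (phi : Q -> M).
Hypothesis lphi : corner_linear phi.

Lemma corner_linear_f q : phi q •> f = phi q.
Proof. by rewrite -[f]/(val (1 : G)) -lphi.2 scale1r. Qed.

Lemma corner_linear0 : phi 0 = 0.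
Proof. by apply: (addrI (phi 0)); rewrite -lphi.1 !addr0. Qed.

Lemma corner_linear_comp (N : lmodType A^c) (h : {linear M -> N}) :
  corner_linear (h \o phi).
Proof.
split=> [q q'|g q] /=; first by rewrite lphi.1 linearD.
by rewrite lphi.2 linearZ.
Qed.

End CornerLinear.

Section CornerPart.
Variable M : lmodType A^c.
(** The fAf-module Mf of an A-module M, as the set of fixed points of f. *)
Definition in_fpart : {pred M} := fun x => x •> f == x.
Fact fpart_zmod_closed : zmod_closed in_fpart.
Proof.
split=> [|x y /eqP xf /eqP yf]; apply/eqP; first by rewrite scaler0.
by rewrite scalerBr xf yf.
Qed.
HB.instance Definition _ := GRing.isZmodClosed.Build M in_fpart fpart_zmod_closed.
Definition fpart := {x : M | x \in in_fpart}.
HB.instance Definition _ := SubChoice.on fpart.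
HB.instance Definition _ := [SubChoice_isSubZmodule of fpart by <:].

Fact fpart_act_subproof (g : G) (x : fpart) : val x •> val g \in in_fpart.
Proof. by apply/eqP; rewrite ractA corner_fr. Qed.
Definition fpart_act (g : G^c) (x : fpart) : fpart :=
  Sub (val x •> val (g : G)) (fpart_act_subproof g x).
Lemma fpartP (x : fpart) : val x •> f = val x.
Proof. exact: (eqP (valP x)). Qed.
Fact fpart_actA a b x : fpart_act a (fpart_act b x) = fpart_act (a * b) x.
Proof. by apply: val_inj; rewrite /= ractA. Qed.
Fact fpart_act1 : left_id 1 fpart_act.
Proof. by move=> x; apply: val_inj; rewrite /= fpartP. Qed.
Fact fpart_actDr : right_distributive fpart_act +%R.
Proof. by move=> a x y; apply: val_inj; rewrite /= scalerDr. Qed.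
Fact fpart_actDl x : {morph fpart_act^~ x : a b / a + b}.
Proof. by move=> a b; apply: val_inj; rewrite /= scalerDl. Qed.
HB.instance Definition _ := GRing.Zmodule_isLmodule.Build G^c fpart
  fpart_actA fpart_act1 fpart_actDr fpart_actDl.
Lemma fpart_val_linear : corner_linear (val : fpart -> M).
Proof. by []. Qed.
Lemma fpart_factor (Q : lmodType G^c) (phi : Q -> M) : corner_linear phi ->
  exists h : {linear Q -> fpart}, forall q, val (h q) = phi q.
Proof.
move=> lphi; have Hphi q : phi q \in in_fpart by apply/eqP; apply: corner_linear_f.
have [h hE] : exists h : {linear Q -> fpart}, h =1 (fun q => Sub (phi q) (Hphi q) : fpart).
  apply: linear_map_exists => a x y; apply: val_inj => /=.
  by rewrite lphi.1; congr (_ + _); apply: lphi.2.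
by exists h => q; rewrite hE.
Qed.

End CornerPart.

(** The functor M |-> Mf is exact, so fAf-linear maps from a projective Q lift along
surjections of A-modules. *)
Lemma projective_corner_lift (Q : lmodType G^c) (M N : lmodType A^c)
    (p : {linear M -> N}) (phi : Q -> N) :
  projective Q -> (forall y, exists x, p x = y) -> corner_linear phi ->
  exists2 psi : Q -> M, corner_linear psi & forall q, p (psi q) = phi q.
Proof.
move=> PQ sp lphi; have [g gE] := fpart_factor lphi.
have [pf pfE] : exists pf : {linear fpart M -> fpart N}, forall x, val (pf x) = p (val x).
  by apply: fpart_factor; exact: (corner_linear_comp (@fpart_val_linear M) p).
have [y|h hE] := PQ _ _ pf g.
  have [x px] := sp (val y).
  have xf : x •> f \in @in_fpart M by apply/eqP; rewrite ractA idemP.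
  exists (Sub (x •> f) xf); apply: val_inj.
  by rewrite pfE SubK linearZ /= px fpartP.
exists (val \o h); first by split=> [q q'|a q] /=; rewrite ?linearD ?linearZ.
by move=> q /=; rewrite -pfE hE gE.
Qed.

End CornerModules.

Section Induced.
Variables (A : pzRingType) (fi : idem A) (Q : lmodType (corner fi)^c).
Local Notation f := (idem_val fi).
Local Notation G := (corner fi).

(** The value under phi of a formal sum of pairs (q, a). *)
Definition formal_eval (M : lmodType A^c) (phi : Q -> M) (s : seq (Q * A)) : M :=
  \sum_(t <- s) phi t.1 •> t.2.

Definition formal_eq (s t : seq (Q * A)) : bool :=
  `[< forall (M : lmodType A^c) (phi : Q -> M), corner_linear phi ->
        formal_eval phi s = formal_eval phi t >].

Fact formal_eq_refl : reflexive formal_eq.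
Proof. by move=> s; apply/asboolP. Qed.
Fact formal_eq_sym : symmetric formal_eq.
Proof. by move=> s t; apply: asbool_equiv_eq; split=> H M phi /H. Qed.
Fact formal_eq_trans : transitive formal_eq.
Proof.
by move=> s t u /asboolP H /asboolP H'; apply/asboolP => M phi lphi; rewrite H // H'.
Qed.
Canonical formal_equiv :=
  EquivRel formal_eq formal_eq_refl formal_eq_sym formal_eq_trans.

(** The A-module obtained from Q by tensoring with fA over fAf: formal sums of
pairs (q, a), standing for the tensors of q and fa, where two sums are identified
when every fAf-linear map from Q to an A-module evaluates them equally.  The
universal property is thus part of the definition. *)
Definition induced : Type := {eq_quot formal_equiv}.
HB.instance Definition _ := Choice.on induced.

Definition induced_pi (s : seq (Q * A)) : induced := \pi_({eq_quot formal_equiv}) s.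
Definition induced_repr (x : induced) : seq (Q * A) := repr (x : {eq_quot formal_equiv}).

Definition induced_eval (M : lmodType A^c) (phi : Q -> M) (x : induced) : M :=
  formal_eval phi (induced_repr x).

Lemma induced_eval_pi (M : lmodType A^c) (phi : Q -> M) s : corner_linear phi ->
  induced_eval phi (induced_pi s) = formal_eval phi s.
Proof.
move=> lphi; rewrite /induced_eval /induced_repr /induced_pi.
case: piP => t /eqmodP /asboolP H; exact/esym/H.
Qed.

Lemma induced_ext (x y : induced) :
  (forall (M : lmodType A^c) (phi : Q -> M), corner_linear phi ->
     induced_eval phi x = induced_eval phi y) -> x = y.
Proof.
move=> H; rewrite -[x]reprK -[y]reprK; apply/eqmodP/asboolP; exact: H.
Qed.

Definition induced_add (x y : induced) := induced_pi (induced_repr x ++ induced_repr y).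
Definition induced_opp (x : induced) := induced_pi [seq (t.1, - t.2) | t <- induced_repr x].
Definition induced_act (a : A^c) (x : induced) :=
  induced_pi [seq (t.1, t.2 * (a : A)) | t <- induced_repr x].

Section Eval.
Variables (M : lmodType A^c) (phi : Q -> M).
Hypothesis lphi : corner_linear phi.
Local Notation ev := (induced_eval phi).
Lemma induced_eval0 : ev (induced_pi [::]) = 0.
Proof. by rewrite induced_eval_pi // /formal_eval big_nil. Qed.
Lemma induced_evalD x y : ev (induced_add x y) = ev x + ev y.
Proof. by rewrite induced_eval_pi // /formal_eval big_cat. Qed.
Lemma induced_evalN x : ev (induced_opp x) = - ev x.
Proof.
rewrite induced_eval_pi // /formal_eval big_map -sumrN.
by apply: eq_bigr => t _; rewrite scaleNr.
Qed.
Lemma induced_evalZ a x : ev (induced_act a x) = ev x •> (a : A).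
Proof.
rewrite induced_eval_pi // /formal_eval big_map scaler_sumr.
by apply: eq_bigr => t _; rewrite ractA.
Qed.
End Eval.

Let evE M phi (l : @corner_linear A fi Q M phi) :=
  (induced_evalD l, induced_evalN l, induced_evalZ l, induced_eval0 l).

Fact induced_addA : associative induced_add.
Proof. by move=> x y z; apply: induced_ext => M phi l; rewrite !(evE l) addrA. Qed.
Fact induced_addC : commutative induced_add.
Proof. by move=> x y; apply: induced_ext => M phi l; rewrite !(evE l) addrC. Qed.
Fact induced_add0 : left_id (induced_pi [::]) induced_add.
Proof. by move=> x; apply: induced_ext => M phi l; rewrite !(evE l) add0r. Qed.
Fact induced_addN : left_inverse (induced_pi [::]) induced_opp induced_add.
Proof. by move=> x; apply: induced_ext => M phi l; rewrite !(evE l) addNr. Qed.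
HB.instance Definition _ := GRing.isZmodule.Build induced
  induced_addA induced_addC induced_add0 induced_addN.

Fact induced_actA a b x : induced_act a (induced_act b x) = induced_act (a * b) x.
Proof. by apply: induced_ext => M phi l; rewrite !(evE l) ractA. Qed.
Fact induced_act1 : left_id 1 induced_act.
Proof. by move=> x; apply: induced_ext => M phi l; rewrite !(evE l) scale1r. Qed.
Fact induced_actDr : right_distributive induced_act +%R.
Proof.
by move=> a x y; apply: induced_ext => M phi l; rewrite !(evE l) scalerDr.
Qed.
Fact induced_actDl x : {morph induced_act^~ x : a b / a + b}.
Proof. by move=> a b; apply: induced_ext => M phi l; rewrite !(evE l) scalerDl. Qed.
HB.instance Definition _ := GRing.Zmodule_isLmodule.Build A^c induced
  induced_actA induced_act1 induced_actDr induced_actDl.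

(** The universal fAf-linear map from Q to the induced module. *)
Definition induced_unit (q : Q) : induced := induced_pi [:: (q, 1)].
Local Notation u := induced_unit.

Lemma induced_eval_unit (M : lmodType A^c) (phi : Q -> M) q : corner_linear phi ->
  induced_eval phi (u q) = phi q.
Proof. by move=> l; rewrite induced_eval_pi // /formal_eval big_seq1 scale1r. Qed.

Lemma induced_unit_linear : corner_linear (u : Q -> induced).
Proof.
split=> [q q'|g q]; apply: induced_ext => M phi l.
  by rewrite (induced_evalD l) !induced_eval_unit // l.1.
by rewrite (induced_evalZ l) !induced_eval_unit // l.2.
Qed.

Lemma induced_eval_linear (M : lmodType A^c) (phi : Q -> M) : corner_linear phi ->
  exists h : {linear induced -> M}, h =1 induced_eval phi.
Proof.
by move=> l; apply: linear_map_exists => a x y; rewrite (induced_evalD l) (induced_evalZ l).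
Qed.

Lemma induced_lift (M : lmodType A^c) (phi : Q -> M) : corner_linear phi ->
  exists h : {linear induced -> M}, forall q, h (u q) = phi q.
Proof.
move=> l; have [h hE] := induced_eval_linear l.
by exists h => q; rewrite hE induced_eval_unit.
Qed.

Lemma induced_ind (P : induced -> Prop) : P 0 ->
  (forall x y, P x -> P y -> P (x + y)) -> (forall q (a : A), P (u q •> a)) ->
  forall x, P x.
Proof.
move=> P0 PD PZ x; have -> : x = \sum_(t <- induced_repr x) u t.1 •> t.2.
  apply: induced_ext => M phi l; have [h hE] := induced_eval_linear l.
  rewrite -!hE linear_sum hE; apply: eq_bigr => t _.
  by rewrite linearZ /= hE induced_eval_unit.
by apply: big_ind => // t _; apply: PZ.
Qed.

Lemma induced_eq0 (M : lmodType A^c) (h : {linear induced -> M}) :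
  (forall q, h (u q) = 0) -> forall x, h x = 0.
Proof.
move=> hu; apply: induced_ind => [|x y hx hy|q a]; first exact: linear0.
  by rewrite linearD hx hy addr0.
by rewrite linearZ /= hu scaler0.
Qed.

(** Every element of the f-part of the induced module comes from Q. *)
Lemma induced_fpart (x : induced) : exists q, u q = x •> f.
Proof.
have lu := induced_unit_linear.
elim/induced_ind: x => [|x y [q qE] [q' q'E]|q a].
- by exists 0; rewrite scaler0 (corner_linear0 lu).
- by exists (q + q'); rewrite lu.1 qE q'E scalerDr.
exists (q •> corner_of fi a).
by rewrite lu.2 val_corner_of -(corner_linear_f lu q) !ractA !mulrA idemP.
Qed.

Lemma induced_projective : projective Q -> projective (induced : lmodType A^c).
Proof.
move=> PQ M N p g sp.
have [psi lpsi psiE] :=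
  projective_corner_lift PQ sp (corner_linear_comp induced_unit_linear g).
have [h hE] := induced_lift lpsi.
exists h => x; apply/subr0_eq.
pose d : {linear induced -> N} := (p \o h) \- g.
by apply: (@induced_eq0 N d) => q; rewrite /d /= hE psiE subrr.
Qed.

End Induced.

Section InducedUnit.
Variables (k : fieldType) (A : algType k) (fi : idem A) (Q : lmodType (corner fi)^c).
Local Notation f := (idem_val fi).
Local Notation G := (corner fi).

(** The k-vector space underlying a module over the corner ring. *)
Definition corner_kmod : Type := Q.
HB.instance Definition _ := GRing.Zmodule.on corner_kmod.
Definition corner_kmod_scale (c : k) (q : corner_kmod) : corner_kmod :=
  (q : Q) •> corner_of fi c%:A.

Let ccE (c : k) : val (corner_of fi c%:A) = c *: f.
Proof. by rewrite val_corner_of -scalerAr mulr1 -scalerAl idemP. Qed.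

Fact corner_kmod_scaleA a b x :
  corner_kmod_scale a (corner_kmod_scale b x) = corner_kmod_scale (a * b) x.
Proof.
rewrite /corner_kmod_scale ractA; congr (_ *: _); apply: val_inj.
by rewrite val_cornerM !ccE -scalerAl -scalerAr scalerA idemP mulrC.
Qed.
Fact corner_kmod_scale1 : left_id 1 corner_kmod_scale.
Proof.
move=> x; rewrite /corner_kmod_scale -[RHS]scale1r; congr (_ *: _); apply: val_inj.
by rewrite ccE scale1r.
Qed.
Fact corner_kmod_scaleDr : right_distributive corner_kmod_scale +%R.
Proof. by move=> a x y; rewrite /corner_kmod_scale scalerDr. Qed.
Fact corner_kmod_scaleDl x : {morph corner_kmod_scale^~ x : a b / a + b}.
Proof.
move=> a b; rewrite /corner_kmod_scale -[RHS]scalerDl; congr (_ *: _); apply: val_inj.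
by rewrite val_cornerD !ccE scalerDl.
Qed.
HB.instance Definition _ := GRing.Zmodule_isLmodule.Build k corner_kmod
  corner_kmod_scaleA corner_kmod_scale1 corner_kmod_scaleDr corner_kmod_scaleDl.

Fact coaction_subproof (q : Q) :
  (fun b => q •> corner_of fi b : corner_kmod) \in @coind_pred k A corner_kmod.
Proof.
apply/asboolP => c x y.
change (q •> corner_of fi (c *: x + y) =
  q •> corner_of fi x •> corner_of fi c%:A + q •> corner_of fi y).
rewrite ractA -scalerDl; congr (_ *: _); apply: val_inj.
rewrite val_cornerD val_cornerM ccE !val_corner_of.
by rewrite mulrDr mulrDl -!scalerAr -!scalerAl -!mulrA idemP.
Qed.
(** The map from Q to Hom_k(A, Q) sending q to b |-> q (fbf).  It is fAf-linear and
evaluation at 1 recovers q, so it detects that the universal map is injective. *)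
Definition coaction (q : Q) : coind A corner_kmod :=
  Sub (fun b => q •> corner_of fi b : corner_kmod) (coaction_subproof q).

Lemma coaction_linear : corner_linear coaction.
Proof.
split=> [q q'|g q]; apply: val_inj; apply/funext => b.
  exact: (scalerDr (corner_of fi b : G^c) q q').
change (q •> g •> corner_of fi b = q •> corner_of fi (val g * b)).
rewrite ractA; congr (_ *: _); apply: val_inj.
by rewrite val_cornerM !val_corner_of !mulrA corner_fl corner_fr.
Qed.

Lemma induced_unit_inj (q : Q) : induced_unit q = 0 -> q = 0.
Proof.
have [h hE] := induced_lift coaction_linear.
move=> u0; have := hE q; rewrite u0 linear0.
move=> /(congr1 (fun g : coind A corner_kmod => val g 1)).
move=> /= /esym; rewrite -[RHS]/(0 : Q) => <-.
rewrite -[LHS]scale1r; congr (_ *: _); apply: val_inj.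
by rewrite val_corner_of mulr1 idemP.
Qed.
End InducedUnit.

(** * The radical of a basic algebra *)

(** Otherwise the right ideal generated by 1 - r would lie in a maximal one, which
also contains r. *)
Lemma jrad_right_inv (R : pzRingType) (r : R) : jrad r -> exists s, (1 - r) * s = 1.
Proof.
move=> Jr; apply: contrapT => ns.
(* The empty set is allowed because it is the union of the empty chain. *)
pose P (I : set R) := I = set0 \/ [/\ right_ideal I, I (1 - r) & ~ I 1].
have [F FP Ftot|I [PI Imax]] := @Zorn_bigcup R P.
  have [|] := pselect (exists2 I, F I & I !=set0); last first.
    move=> nF; left; apply/seteqP; split=> [x [I FI Ix]|//].
    by apply: nF; exists I => //; exists x.
  move=> [I0 FI0 [x0 I0x0]]; right.
  have FQ I x : F I -> I x -> [/\ right_ideal I, I (1 - r) & ~ I 1].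
    by move=> /FP[->|].
  have [[I00 _ _] I0r _] := FQ _ _ FI0 I0x0.
  split; last 2 first.
  - by exists I0.
  - by move=> [I FI I1]; have [_ _ []] := FQ _ _ FI I1.
  split; first by exists I0.
    move=> x y [I FI Ix] [I' FI' I'y].
    have [II'|I'I] := Ftot _ _ FI FI'.
      by exists I' => //; have [[_ + _] _ _] := FQ _ _ FI' I'y; apply=> //; apply: II'.
    by exists I => //; have [[_ + _] _ _] := FQ _ _ FI Ix; apply=> //; apply: I'I.
  move=> x a [I FI Ix]; exists I => //.
  by have [[_ _ +] _ _] := FQ _ _ FI Ix; apply.
pose I1 := [set x : R | exists a, x = (1 - r) * a].
have PI1 : P I1.
  right; split.
  - split; first by exists 0; rewrite mulr0.
      by move=> _ _ [a ->] [b ->]; exists (a + b); rewrite mulrDr.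
    by move=> _ b [a ->]; exists (a * b); rewrite mulrA.
  - by exists 1; rewrite mulr1.
  - by move=> [a aE]; apply: ns; exists a.
case: PI => [I0|[rI Ir nI1]].
  apply: (Imax I1) => //; rewrite I0 properEneq; split=> //.
  by apply/eqP => e; have : set0 (1 - r) by rewrite e; exists 1; rewrite mulr1.
have mI : maximal_right_ideal I.
  split=> // [e|J rJ IJ]; first by rewrite e in nI1; apply: nI1.
  have [J1|nJ1] := pselect (J 1).
    right; apply/seteqP; split=> // x _.
    by have [_ _ JM] := rJ; rewrite -[x]mul1r; apply: JM.
  left; apply: contrapT => nJI; apply: (Imax J).
    by rewrite properEneq; split=> //; apply/eqP => e; apply: nJI.
  by right; split=> //; apply: IJ.
apply: nI1; rewrite -(subrK r 1).
by have [_ ID _] := rI; apply: ID => //; apply: Jr.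
Qed.

Lemma jrad_left_inv (R : pzRingType) (r : R) : jrad r -> exists s, s * (1 - r) = 1.
Proof.
move=> Jr; have [s sE] := jrad_right_inv Jr; exists s.
have [_ _ JM] := rad_right_ideal R.
have sr : s = 1 - (- (r * s)) by rewrite opprK -{1}sE mulrBl mul1r subrK.
have [|t tE] := @jrad_right_inv R (- (r * s)).
  by rewrite -mulrN; apply: JM.
rewrite -sr in tE.
by have := congr1 ( *%R (1 - r)) tE; rewrite /= mulrA sE mul1r mulr1 => <-.
Qed.

(** Products of n elements of the Jacobson radical. *)
Inductive jrad_prod (R : pzRingType) : nat -> R -> Prop :=
| jrad_prod0 : jrad_prod 0 1
| jrad_prodS n u r : jrad_prod n u -> jrad r -> jrad_prod n.+1 (u * r).

Lemma jrad_prodX (R : pzRingType) (x : R) n : jrad x -> jrad_prod n (x ^+ n).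
Proof. by move=> Jx; elim: n => [|n IH]; rewrite ?expr0 ?exprSr; constructor. Qed.

Section Nilpotent.
Variables (k : fieldType) (A : falgType k).
Variable J : {vspace A}.
Hypothesis JE : forall x, x \in J <-> jrad x.

(** Hopkins' argument.  Let U be a power of J of minimal dimension, so that UU = U.
If U is nonzero, take w in U with Uw nonzero of minimal dimension; then some v in
Uw satisfies Uv = Uw, hence v = uv with u in U, and v = 0 as 1 - u is invertible. *)
Lemma jrad_vspace_nilpotent : exists n, (J ^+ n.+1)%VS = 0%VS.
Proof.
pose D d := `[< exists n, \dim (J ^+ n.+1) = d >].
have exD : exists d, D d by exists (\dim (J ^+ 1)); apply/asboolP; exists 0%N.
case: (ex_minnP exD) => d /asboolP[n dn] dmin; exists n.
have [_ _ JM] := rad_right_ideal A.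
have JJ : (J * J <= J)%VS by apply/prodvP => x y /JE Jx /JE Jy; apply/JE; apply: JM.
have expS m : (J ^+ m.+2 <= J ^+ m.+1)%VS.
  case: m => [|m]; first by rewrite expv2 expv1.
  by rewrite (expvSl J m.+2) (expvSl J m.+1) prodvA prodvSl.
pose U := (J ^+ n.+1)%VS.
have UJ : (U * J = U)%VS.
  apply/eqP; rewrite eqEdim -expvSr expS /= /U dn.
  by apply: dmin; apply/asboolP; exists n.+1.
have UJm m : (U * J ^+ m = U)%VS.
  by elim: m => [|m IH]; rewrite ?expv0 ?prodv1 // expvSr prodvA IH.
have UU : (U * U = U)%VS by exact: UJm.
have UsJ : (U <= J)%VS.
  by rewrite /U; elim: (n) => [|m IH]; [rewrite expv1 | apply: subv_trans IH].
apply: contrapT => U0.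
pose E d := `[< exists w, [/\ w \in U, (U * <[w]>)%VS != 0%VS & \dim (U * <[w]>) = d] >].
have exE : exists d, E d.
  apply: contrapT => nE; apply: U0; rewrite -/U -UU; apply/eqP; rewrite -subv0.
  apply/prodvP => u w Uu Uw; rewrite memv0; apply: contrapT => /negP uw0; apply: nE.
  exists (\dim (U * <[w]>)); apply/asboolP; exists w; split=> //.
  apply: contraNN uw0 => /eqP Uw0; rewrite -memv0 -Uw0.
  by apply: memv_mul => //; apply: memv_line.
case: (ex_minnP exE) => c /asboolP[w [Uw Uw0 dw]] cmin.
have [v vUw Uv0] : exists2 v, v \in (U * <[w]>)%VS & (U * <[v]>)%VS != 0%VS.
  apply: contrapT => nv; case/negP: Uw0; rewrite -UU -prodvA -subv0.
  apply/prodvP => u v Uu Uwv; rewrite memv0; apply: contrapT => /negP uv0; apply: nv.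
  exists v => //; apply: contraNN uv0 => /eqP Uv0; rewrite -memv0 -Uv0.
  by apply: memv_mul => //; apply: memv_line.
have vw : (<[v]> <= U * <[w]>)%VS by [].
have Uvw : (U * <[v]> = U * <[w]>)%VS.
  apply/eqP; rewrite eqEdim -{2}UU -prodvA prodvSr //= dw; apply: cmin.
  apply/asboolP; exists v; split=> //.
  by rewrite -UU; apply: (subvP (prodvSr U _)) vUw; rewrite -memvE.
move: vUw; rewrite -Uvw => /memv_cosetP[u Uu vE].
have [s sE] : exists s, s * (1 - u) = 1 by apply/jrad_left_inv/JE/(subvP UsJ).
case/negP: Uv0; suff -> : v = 0 by rewrite prodv0.
by rewrite -[v]mul1r -sE -mulrA mulrBl mul1r -vE subrr mulr0.
Qed.

Lemma jrad_prod_nilpotent : exists n, forall u : A, jrad_prod n u -> u = 0.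
Proof.
have [n n0] := jrad_vspace_nilpotent; exists n.+1 => u Ju.
apply/eqP; rewrite -memv0 -n0.
elim: Ju => [|m v r _ IH Jr]; first by rewrite expv0 memv_line.
by rewrite expvSr memv_mul //; apply/JE.
Qed.

End Nilpotent.

Section Basic.
Variables (k : fieldType) (A : falgType k) (ei : idem A).
Local Notation e := (idem_val ei).
Hypotheses (bA : basic A) (pe : primitive ei).

Lemma basic_nilpotent : exists n, forall u : A, jrad_prod n u -> u = 0.
Proof.
have [n [phi [phiZ _ phiK]]] := bA.
have [psi psiE] : exists g : {linear A -> 'rV[k]_n}, g =1 (fun x => \row_i phi x i).
  apply: linear_map_exists => c x y; apply/rowP => i.
  by rewrite !mxE rmorphD !ffunE phiZ.
apply: (@jrad_prod_nilpotent k A (lker (linfun psi))) => x.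
rewrite memv_ker lfunE /= psiE -phiK; split=> [/eqP/rowP x0|->].
  by apply/ffunP => i; have := x0 i; rewrite !mxE ffunE.
by apply/eqP/rowP => i; rewrite !mxE ffunE.
Qed.

Lemma basic_jrad_mull (a r : A) : jrad r -> jrad (a * r).
Proof.
by have [n [phi [_ _ phiK]]] := bA; rewrite -!phiK rmorphM => ->; rewrite mulr0.
Qed.

Lemma primitive_notin_jrad : ~ jrad e.
Proof.
move=> /jrad_right_inv[s sE]; case: pe => e0 _; apply: e0.
by rewrite -[e]mulr1 -sE mulrA mulrBr mulr1 idemP subrr mul0r.
Qed.

(** Commutativity of A / rad A puts eA(1 - e) in the radical. *)
Lemma basic_peirce_jrad (a : A) : jrad (e * a * (1 - e)).
Proof.
have [n [phi [_ _ phiK]]] := bA; apply/phiK/ffunP => i.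
have phiM x y : phi (x * y) i = phi x i * phi y i by rewrite rmorphM ffunE.
by rewrite !phiM mulrAC -phiM mulrBr mulr1 idemP subrr raddf0 !ffunE mul0r.
Qed.

(** Lifting idempotents: evaluate at y a Bezout relation between the n-th powers of
X and 1 - X. *)
Lemma lift_idem (y : A) n : (0 < n)%N -> (y * (1 - y)) ^+ n = 0 ->
  exists (g u v : A), [/\ g * g = g, g = u * y ^+ n, 1 - g = v * (1 - y) ^+ n & GRing.comm u y].
Proof.
move=> n0 yn.
have cp : coprimep ('X ^+ n : {poly k}) ((1 - 'X) ^+ n).
  apply/coprimep_expl/coprimep_expr/Bezout_eq1_coprimepP.
  by exists (1, 1); rewrite /= !mul1r addrC subrK.
have /Bezout_eq1_coprimepP[[u v] /= uv] := cp.
pose h : {rmorphism {poly k} -> A} := horner_alg y.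
have hX : h 'X = y by rewrite /h /= horner_algX.
have h1X : h (1 - 'X) = 1 - y by rewrite rmorphB rmorph1 hX.
have hX1 : h ('X * (1 - 'X)) = y * (1 - y) by rewrite rmorphM h1X hX.
have hg : h (v * (1 - 'X) ^+ n) = 1 - h (u * 'X ^+ n).
  by apply/esym/eqP; rewrite subr_eq -rmorphD [v * _ + _]addrC uv rmorph1.
exists (h (u * 'X ^+ n)), (h u), (h v); split.
- apply/subr0_eq/eqP; rewrite -oppr_eq0 opprB -{1}[h _]mulr1 -mulrBr -hg -rmorphM.
  by rewrite mulrACA -exprMn rmorphM rmorphXn hX1 yn mulr0.
- by rewrite rmorphM rmorphXn hX.
- by rewrite -hg rmorphM rmorphXn h1X.
- by rewrite /GRing.comm -hX -!rmorphM mulrC.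
Qed.

(** S_e is one-dimensional: modulo the radical, ea is a scalar multiple of e.
Otherwise the image of e in k^n would be a sum of two nonzero orthogonal
idempotents, and lifting one of them to eAe would split e. *)
Lemma primitive_scal (a : A) : exists c : k, jrad (e * a - c *: e).
Proof.
have [n [phi [phiZ phiS phiK]]] := bA.
have phiM x y i : phi (x * y) i = phi x i * phi y i by rewrite rmorphM ffunE.
have phiD x y i : phi (x - y) i = phi x i - phi y i by rewrite rmorphB !ffunE.
have phi1 i : phi 1 i = 1 by rewrite rmorph1 ffunE.
have phie i : phi e i = 0 \/ phi e i = 1.
  have /eqP := phiM e e i; rewrite idemP -subr_eq0 -{1}[phi e i]mulr1 -mulrBr.
  by rewrite mulf_eq0 subr_eq0 => /orP[] /eqP; [left | right].
have [i0 ei0] : exists i0, phi e i0 = 1.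
  apply: contrapT => ne; apply: primitive_notin_jrad; apply/phiK/ffunP => i; rewrite ffunE.
  by have [|e1] := phie i => //; case: ne; exists i.
suff ephi i : i != i0 -> phi e i = 0.
  exists (phi a i0); apply/phiK/ffunP => i; rewrite phiD phiM phiZ ffunE.
  by have [->|/ephi ->] := eqVneq i i0; rewrite ?ei0 ?mul1r ?mulr1 ?mul0r ?mulr0 subrr.
move=> ii0; have [//|ei1] := phie i.
(* y in eAe lifts the idempotent of k^n supported at i0. *)
have [x xE] := phiS [ffun j => (j == i0)%:R].
pose y := e * x * e.
have phiy j : phi y j = (j == i0)%:R.
  rewrite !phiM xE ffunE; case: eqVneq => [->|_]; last by rewrite mulr0 mul0r.
  by rewrite ei0 !mulr1.
have [N JN] := basic_nilpotent.
have yN : (y * (1 - y)) ^+ N = 0.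
  apply/JN/jrad_prodX/phiK/ffunP => i'; rewrite phiM phiD phi1 phiy ffunE.
  by case: eqP; rewrite ?subrr ?mulr0 ?mul0r.
have yN1 : (y * (1 - y)) ^+ N.+1 = 0 by rewrite exprS yN mulr0.
have [g [u [v [gg gu gv gy]]]] := lift_idem (ltn0Sn N) yN1.
have ge : g * e = g.
  by rewrite gu exprSr !mulrA -!mulrA; congr (_ * _); rewrite idemP.
have eg : e * g = g.
  by rewrite gu exprS mulrA gy /y !mulrA idemP.
have egg : (e - g) * (e - g) = e - g.
  by rewrite mulrBl !mulrBr idemP ge eg gg subrr subr0.
case: pe => _ /(_ (Idem gg) (Idem egg)) /=.
case.
- by rewrite mulrBr ge gg subrr.
- by rewrite mulrBl eg gg subrr.
- by rewrite addrC subrK.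
- move=> g0; have /eqP := congr1 (fun z => phi z i0) gv.
  rewrite /= g0 subr0 phi1 exprSr mulrA phiM phiD phi1 phiy eqxx subrr mulr0.
  by rewrite oner_eq0.
move=> eg0; have /eqP := congr1 (fun z => phi z i) gu.
rewrite /= -(subr0_eq eg0) ei1 exprSr mulrA phiM phiy (negbTE ii0) mulr0.
by rewrite oner_eq0.
Qed.
End Basic.

(** * The simple module at a primitive idempotent *)

Section TopModule.
Variables (A : pzRingType) (ei : idem A).
Local Notation e := (idem_val ei).
Local Notation f := (1 - e).

Fact eR_gen_subproof : e \in in_eR e.
Proof. by apply/asboolP; exists 1; rewrite mulr1. Qed.
(** The generator e of eA. *)
Definition eR_gen : eR e := Sub e eR_gen_subproof.

Lemma eR_valZ (x : eR e) (a : A) : val (x •> a) = val x * a. Proof. by []. Qed.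

Lemma eR_val (x : eR e) : e * val x = val x.
Proof. by have /asboolP[a ->] := valP x; rewrite mulrA idemP. Qed.

Lemma eR_genZ (x : eR e) : x = eR_gen •> val x.
Proof. by apply: val_inj; rewrite eR_valZ eR_val. Qed.

Lemma ract_idem_id (M : lmodType A^c) (x : M) : x •> f = 0 -> x •> e = x.
Proof. by move=> xf; rewrite -[LHS]add0r -xf -scalerDl subrK scale1r. Qed.

Lemma eR_map (M : lmodType A^c) (m : M) :
  exists h : {linear eR e -> M}, forall x, h x = m •> val x.
Proof. by apply: linear_map_exists => a x y; rewrite ractA -scalerDl. Qed.

Lemma eR_projective : projective (eR e : lmodType A^c).
Proof.
move=> M N p g sp; have [m mE] := sp (g eR_gen).
have [h hE] := eR_map m; exists h => x.
by rewrite hE linearZ /= mE [in RHS](eR_genZ x) linearZ.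
Qed.

Definition top_pi : eR e -> top_eR e := quotmod_pi (in_eradR_submod_closed e).

Lemma top_pi_linear : exists p : {linear eR e -> top_eR e},
  (forall y, exists x, p x = y) /\
  (forall x, p x = 0 <-> exists2 r, jrad r & val x = e * r).
Proof.
have [p pE] : exists p : {linear eR e -> top_eR e}, p =1 top_pi.
  by apply: linear_map_exists => a x y; rewrite /top_pi quotmod_piD -quotmod_piZ.
exists p; split=> [y|x].
  by have [x <-] := quotmod_piP y; exists x; rewrite pE.
have -> : 0 = top_pi 0 by rewrite -pE linear0.
by rewrite pE quotmod_pi_eq subr0; split=> /asboolP.
Qed.

End TopModule.

Section Simple.
Variables (k : fieldType) (A : falgType k) (ei : idem A).
Local Notation e := (idem_val ei).
Local Notation f := (1 - e).
Hypotheses (bA : basic A) (pe : primitive ei).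
Implicit Types M N H : lmodType A^c.

(** Mf = 0, where f = 1 - e. *)
Definition fnull M := forall x : M, x •> f = 0.

(** x is annihilated by f = 1 - e and by the radical, that is, x lies in the
S_e-isotypic part of the socle of M. *)
Definition in_soc M (x : M) := x •> f = 0 /\ forall r : A, jrad r -> x •> r = 0.

(** A acts on such elements through scalars, the same for all modules. *)
Lemma soc_scal (a : A) : exists c : k, forall M (x : M), in_soc x -> x •> a = x •> (c%:A : A).
Proof.
have [c cJ] := primitive_scal bA pe a; exists c => M x [xf xJ].
have xe := ract_idem_id xf; apply/subr0_eq; rewrite -xe !ractA -scalerBl.
have := xJ _ cJ.
by rewrite -{1}xe ractA mulrBr mulrA idemP -!scalerAr idemP mulr1.
Qed.

(** S_e is generated by s0, which is universal among the elements in [in_soc]. *)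
Lemma top_generator : exists s0 : top_eR e,
  [/\ s0 <> 0, in_soc s0, forall s, exists a : A, s = s0 •> a &
      forall M (x : M), in_soc x -> exists h : {linear top_eR e -> M}, h s0 = x].
Proof.
have [p [sp kp]] := top_pi_linear ei.
exists (p (eR_gen ei)); split.
- move=> /kp[r Jr]; rewrite SubK => er.
  by apply: (primitive_notin_jrad pe); rewrite er; apply: basic_jrad_mull.
- split=> [|r Jr]; rewrite -linearZ; apply/kp.
    exists (e * f); last by rewrite /= mulrA idemP.
    by rewrite -[X in X * f]idemP; apply: basic_peirce_jrad.
  by exists r.
- by move=> s; have [x <-] := sp s; exists (val x); rewrite [x in LHS]eR_genZ linearZ.
move=> M x [xf xJ]; have [h hE] := eR_map ei x.
have [|g gE] := factor_surj (g := h) sp.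
  move=> y /kp[r Jr yE]; rewrite hE yE -ractA (ract_idem_id xf); exact: xJ.
by exists g; rewrite gE hE ract_idem_id.
Qed.

Lemma top_fnull : fnull (top_eR e).
Proof.
have [s0 [_ _ sA _]] := top_generator.
have [p [sp kp]] := top_pi_linear ei.
move=> s; have [x <-] := sp s; rewrite -linearZ; apply/kp.
exists (val x * f); last by rewrite eR_valZ mulrA eR_val.
by rewrite -eR_val; apply: basic_peirce_jrad.
Qed.

(** A nonzero module has a nonzero element annihilated by the radical. *)
Lemma soc_eq0 M : (forall x : M, (forall r : A, jrad r -> x •> r = 0) -> x = 0) ->
  trivial_mod M.
Proof.
move=> H x; have [n n0] := basic_nilpotent bA.
have {n0} : forall u : A, jrad_prod n u -> x •> u = 0.
  by move=> u /n0 ->; rewrite scale0r.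
elim: n => [|n IH] xn; first by rewrite -[x]scale1r; apply: xn; exact: jrad_prod0.
apply: IH => u un; apply: H => r Jr.
by rewrite ractA; apply: xn; constructor.
Qed.

Section Vanish.
Variable C : coresolution A^c.
Hypothesis CE : cos_T C 0%N = top_eR e.
Local Notation V := (ext_vanish C).
Local Notation S := (top_eR e : lmodType A^c).

(** The case of a direct sum of copies of S_e, possibly infinite: A-linear maps out
of M are the k-linear ones with values in the socle. *)
Lemma ext_vanish_soc j M : V j S -> (forall x : M, in_soc x) -> V j M.
Proof.
have [s0 [_ [s0f s0J] _ s0map]] := top_generator.
move=> VS Msoc g.
have [gk gkE] := kmod_linear g.
have [pk pkE] := kmod_linear (cos_pi C j).
have [|||s sE] := @vectspace_lift k (kmod M) (kmod (cos_J C j)) (kmod (cos_T C j)) pk gk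
   (fun y => in_soc (y : cos_J C j)).
- by split=> *; rewrite scaler0.
- move=> c x y [xf xJ] [yf yJ]; rewrite kmodZ.
  have sc (a : A) : x •> (c%:A : A) •> a = x •> a •> (c%:A : A).
    by rewrite !ractA -scalerAl -scalerAr mul1r mulr1.
  by split=> [|r Jr]; rewrite scalerDr sc ?xf ?yf ?xJ ?yJ // scaler0 addr0.
- move=> u; have [uf uJ] := Msoc u.
  have [|h hE] := s0map _ (g u).
    by split=> [|r Jr]; rewrite -linearZ ?uf ?uJ // linear0.
  have [h' h'E] := VS h.
  exists (h' s0); split; last by rewrite pkE h'E hE gkE.
  by split=> [|r Jr]; rewrite -linearZ /= ?s0f ?s0J // linear0.
have [h hE] : exists h : {linear M -> cos_J C j}, h =1 s.
  apply: linear_map_exists => a x y; rewrite linearD; congr (_ + _).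
  have [c cE] := soc_scal a.
  by rewrite !cE -?kmodZ ?linearZ //; apply: (sE x).1.
by exists h => x; rewrite hE -pkE (sE x).2 gkE.
Qed.

(** By induction on the Loewy length. *)
Lemma ext_vanish_fnull j M : V j S -> fnull M -> V j M.
Proof.
move=> VS; have [n n0] := basic_nilpotent bA => Mf.
have {n0} : forall (x : M) (u : A), jrad_prod n u -> x •> u = 0.
  by move=> x u /n0 ->; rewrite scale0r.
elim: n => [|n IH] in M Mf * => Mn.
  by apply: ext_vanish_trivial => x; rewrite -[x]scale1r; apply: Mn; exact: jrad_prod0.
have [||K [Q [i [p [sip iE]]]]] :=
   @submodule_ses _ M (fun x => forall r : A, jrad r -> x •> r = 0).
- by move=> r _; rewrite scaler0.
- move=> a x y xJ yJ r Jr; rewrite scalerDr yJ // addr0 ractA; apply: xJ.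
  exact: basic_jrad_mull.
apply: (ext_vanish_ext sip).
  apply: ext_vanish_soc => // x.
  split=> [|r Jr]; apply: (ses_inj sip); rewrite linear0 linearZ /=.
    exact: Mf.
  by have /iE : exists y, i y = i x by [exists x]; apply.
apply: IH => [y|y u un]; have [x <-] := ses_surj sip y; rewrite -linearZ.
  by rewrite [_ •> _]Mf linear0.
apply/(ses_exact sip)/iE => r Jr.
by rewrite ractA; apply: Mn; constructor.
Qed.

Section Top.
Variable m : nat.
Hypotheses (nVm : ~ V m S) (Vm : forall j, (m < j)%N -> V j S).

Lemma fnull_trivial M : fnull M -> V m M -> trivial_mod M.
Proof.
move=> Mf VM; apply: soc_eq0 => x xJ; apply: contrapT => x0; apply: nVm.
have socx : in_soc x by split.
have [s0 [_ socs0 s0A s0map]] := top_generator.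
have [h hE] := s0map _ _ socx.
have injh : injective h.
  apply: linear_injective0 => s; have [a ->] := s0A s; have [c cE] := soc_scal a.
  rewrite linearZ /= hE !cE // => xc.
  have [->|c0] := eqVneq c 0; first by rewrite scale0r scale0r.
  case: x0; have <- : x •> ((c%:A : A) * (c^-1)%:A) = x.
    by rewrite -scalerAl mul1r scalerA mulfV // scale1r; apply: scale1r.
  by rewrite -ractA xc scaler0.
have [Q [p hp]] := cokernel_ses injh.
apply: (ext_vanish_sub hp) => //; apply: ext_vanish_fnull; first exact: Vm.
by move=> y; have [z <-] := ses_surj hp y; rewrite -linearZ [_ •> _]Mf linear0.
Qed.

Local Notation fi := (compl_idem ei).
Variables (L : lmodType (corner fi)^c) (P : proj_resolution L) (l : nat).
Hypothesis Pl : forall i, (l < i)%N -> trivial_mod (P i).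
Hypothesis m0 : (0 < m)%N.

Lemma induced_vanish (Q : lmodType (corner fi)^c) : projective Q ->
  forall j, V j (induced Q : lmodType A^c).
Proof.
move=> PQ [|j]; last by apply/ext_vanish_projective/induced_projective.
apply/ext_vanish0; rewrite CE => g; apply: induced_eq0 => q.
rewrite -(corner_linear_f (induced_unit_linear Q)) linearZ /=.
exact: top_fnull.
Qed.

(** The descending induction, on the degree i of the resolution P: here Z is an
A-module with an fAf-linear map theta from P_i onto Zf whose kernel is the image of
P_(i+1), and d bounds the distance from i to the length of P. *)
Lemma corner_resolution_vanish d : forall i (Z : lmodType A^c) (theta : P i -> Z),
  (l < i + d)%N -> corner_linear theta ->
  (forall z, exists q, theta q = z •> f) ->
  (forall q, theta q = 0 <-> exists q', res_d P i q' = q) ->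
  (forall j, (m <= j)%N -> V j Z) -> forall j, V j Z.
Proof.
elim: d => [|d IH] i Z theta lid ltheta stheta ktheta VZ.
  rewrite addn0 in lid; move=> j; apply: ext_vanish_trivial.
  apply: fnull_trivial; last exact: VZ.
  move=> z; have [q <-] := stheta z.
  by rewrite [q](Pl lid) (corner_linear0 ltheta).
have VX := induced_vanish (@res_proj _ _ P i).
set X := (induced (P i) : lmodType A^c) in VX *.
have [h hE] := induced_lift ltheta.
(* K is the next module in the induction and B = ZfA the image of X in Z. *)
have [K [B [iK [p [b [sip injb bp iKE]]]]]] := kernel_ses h.
have [H [r sbr]] := cokernel_ses injb.
have Hf : fnull H.
  move=> y; have [z <-] := ses_surj sbr y; rewrite -linearZ.
  have [q qE] := stheta z; rewrite -[_ •> _]qE -hE -bp; exact: (ses_comp sbr).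
have VH j : (m < j)%N -> V j H by move=> mj; apply: ext_vanish_fnull => //; apply: Vm.
have VB j : (m <= j)%N -> V j B.
  by move=> mj; apply: (ext_vanish_sub sbr); [apply: VZ | apply: VH].
have VK j : (m <= j)%N -> V j K.
  by move=> mj; apply: (ext_vanish_sub sip); [apply: VX | apply: VB; apply: leqW].
have /choice[theta' theta'E] : forall q, exists y, iK y = induced_unit (res_d P i q).
  by move=> q; apply/iKE; rewrite hE; apply/ktheta; exists q.
have lu := @induced_unit_linear A fi (P i).
have {}VK j : V j K.
  move: j; apply: (IH i.+1 K theta') => //.
  - by rewrite addSn -addnS.
  - split=> [q q'|g q]; apply: (ses_inj sip).
      by rewrite linearD !theta'E linearD lu.1.
    by rewrite linearZ /= !theta'E linearZ /= lu.2.
  - move=> z; have [q qE] := induced_fpart (iK z).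
    have /ktheta[q' q'E] : theta q = 0.
      by rewrite -hE qE linearZ /= (_ : h (iK z) = 0) ?scaler0 //; apply/iKE; exists z.
    by exists q'; apply: (ses_inj sip); rewrite theta'E q'E qE linearZ.
  move=> q; split=> [q0|/res_exact dq0].
    by apply/res_exact; apply: induced_unit_inj; rewrite -theta'E q0 linear0.
  by apply: (ses_inj sip); rewrite theta'E dq0 linear0 (corner_linear0 lu).
have {}VB j : V j B.
  case: j => [|j]; last exact: (ext_vanish_quot sip (VK j) (VX _)).
  apply/ext_vanish0 => g y; have [x <-] := ses_surj sip y.
  by have /ext_vanish0/(_ (g \o p)) := VX 0%N; apply.
have H0 : trivial_mod H.
  apply: fnull_trivial => //; have := VZ m (leqnn m).
  case: (m) m0 => // m' _ VZm; exact: (ext_vanish_quot sbr (VB m') VZm).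
by move=> j; apply: (ext_vanish_ext sbr (VB j)); apply: ext_vanish_trivial.
Qed.

End Top.

End Vanish.

End Simple.

Theorem mainTheorem2 (k : closedFieldType) (A : falgType k) (e : idem A) :
  basic A -> primitive e ->
  pd_finite (top_eR e) ->
  pd_finite (eRf e (compl_idem e) : lmodType (corner (compl_idem e))^c) ->
  forall i : nat, (0 < i)%N -> Ext_eq0 i (top_eR e) (top_eR e).
Proof.
move=> bA pe pdS [l [P Pl]] [//|i] _.
have [C CE] := coresolution_exists (top_eR e).
rewrite -[X in Ext_eq0 _ _ X]CE; apply: ext_vanish_Ext_eq0.
apply: contrapT => nVi.
pose D j := (0 < j)%N && ~~ `[< ext_vanish C j (top_eR e) >].
have exD : exists j, D j by exists i.+1; apply/asboolP.
have [N NV] := pd_finite_ext_vanish C pdS.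
have DN j : D j -> (j <= N)%N.
  by move=> /andP[_]; apply: contraNleq => /NV H; apply/asboolP.
case: (ex_maxnP exD DN) => m /andP[m0 /asboolP nVm] mmax.
have Vm j : (m < j)%N -> ext_vanish C j (top_eR e).
  move=> mj; apply: contrapT => nV.
  have : (j <= m)%N by apply: mmax; rewrite /D (leq_trans _ mj) //; apply/asboolP.
  by rewrite leqNgt mj.
have V0 : ext_vanish C 0 (eR e : lmodType A^c).
  have Hth q : val (res_aug P q) \in in_eR e.
    have /asboolP[a ->] := valP (res_aug P q).
    by apply/asboolP; exists (a * idem_val (compl_idem e)); rewrite mulrA.
  apply: (corner_resolution_vanish bA pe CE nVm Vm Pl m0 (d := l.+1)
    (theta := fun q => Sub (val (res_aug P q)) (Hth q) : eR e)).
  - by rewrite add0n.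
  - by split=> [q q'|g q]; apply: val_inj; rewrite /= ?linearD ?linearZ.
  - move=> z; have zf : val z * idem_val (compl_idem e) \in in_peirce e (compl_idem e).
      have /asboolP[a ->] := valP z; apply/asboolP; by exists a.
    have [q qE] := res_aug_surj P (Sub (val z * idem_val (compl_idem e)) zf).
    by exists q; apply: val_inj; rewrite SubK qE.
  - move=> q; rewrite -res_aug_exact; split=> [/(congr1 val)|q0]; last first.
      by apply: val_inj; rewrite SubK q0.
    by rewrite SubK => q0; apply: val_inj.
  case=> [|j] mj; first by rewrite leqNgt m0 in mj.
  by apply: ext_vanish_projective; apply: eR_projective.
have [p [_ kp]] := top_pi_linear e.
move: V0 => /ext_vanish0; rewrite CE => /(_ p (eR_gen e)) /kp[r Jr]; rewrite SubK => er.
by apply: (primitive_notin_jrad pe); rewrite er; apply: basic_jrad_mull.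
Qed.
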